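(* Let $A$ and $B$ be C*-algebras, let $(\mathsf{X}, \varphi)$ be an $(A,B)$ C*-correspondence, let $A_0 = A/\ker(\varphi)$, and let $\varphi_0 \colon A_0 \to \mathcal{L}_{B}(\mathsf{X})$ be the injective $*$-homomorphism induced by $\varphi$, which makes $(\mathsf{X}, \varphi_0)$ an $(A_0,B)$ C*-correspondence. Then there is a unique $A_0$-valued left inner product on $\mathsf{X}$ making it a Hilbert $A_0$-$B$-bimodule if and only if $\mathcal{K}_B(\mathsf{X}) \subseteq \varphi(A)$.
   Context: An $(A,B)$ C*-correspondence is a pair $(\mathsf{X},\varphi)$ where $\mathsf{X}$ is a right Hilbert $B$-module and $\varphi\colon A\to\mathcal{L}_B(\mathsf{X})$ is a $*$-homomorphism; here $\mathcal{L}_B(\mathsf{X})$ denotes the C*-algebra of adjointable maps $\mathsf{X}\to\mathsf{X}$. The inner product $\langle-,-\rangle_B$ is linear in the second variable and conjugate linear in the first. For $x,y\in\mathsf{X}$, $\theta_{x,y}\in\mathcal{L}_B(\mathsf{X})$ is given by $\theta_{x,y}(z)=x\langle y,z\rangle_B$, and $\mathcal{K}_B(\mathsf{X})=\overline{\mathrm{span}\{\theta_{x,y}\colon x,y\in\mathsf{X}\}}$ is the algebra of compact-module maps. For C*-algebras $D$ and $B$, a Hilbert $D$-$B$-bimodule is a complex vector space $\mathsf{X}$ that is a left Hilbert $D$-module (with $D$-valued inner product ${}_D\langle-,-\rangle$, linear in the first variable and conjugate linear in the second) and a right Hilbert $B$-module such that ${}_D\langle x,y\rangle z=x\langle y,z\rangle_B$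 for all $x,y,z\in\mathsf{X}$. In the claim, the right Hilbert $B$-module structure is the given one, and the left action of $A_0$ on $\mathsf{X}$ is the one given by $\varphi_0$. *)

(* Defs.v *)
From HB Require Import structures.
From mathcomp Require Import all_boot all_order all_algebra.
From mathcomp Require Import complex.
From mathcomp Require Import all_classical all_reals all_analysis.

Set Implicit Arguments.
Unset Strict Implicit.
Unset Printing Implicit Defensive.

Import Order.TTheory GRing.Theory Num.Theory.

Local Open Scope classical_set_scope.
Local Open Scope ring_scope.

(* MathComp's algebras are unital; C*-algebras need not be, so the product is  *)
(* a separate operation [amul] and no unit is assumed.                        *)
HB.mixin Record Lmodule_isStarAlgebra (R : realType) (A : Type)
    of GRing.Lmodule R[i] A := {
  amul : A -> A -> A;
  star : A -> A;
  amulA : forall a b c, amul a (amul b c) = amul (amul a b) c;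
  amulDl : forall a b c, amul (a + b) c = amul a c + amul b c;
  amulDr : forall a b c, amul a (b + c) = amul a b + amul a c;
  amulZl : forall (k : R[i]) a b, amul (k *: a) b = k *: amul a b;
  amulZr : forall (k : R[i]) a b, amul a (k *: b) = k *: amul a b;
  starD : forall a b, star (a + b) = star a + star b;
  starZ : forall (k : R[i]) a, star (k *: a) = k^* *: star a;
  starM : forall a b, star (amul a b) = amul (star b) (star a);
  starK : forall a, star (star a) = a
}.

#[short(type="starAlgType")]
HB.structure Definition StarAlgebra (R : realType) :=
  {A of Lmodule_isStarAlgebra R A & GRing.Lmodule R[i] A}.

HB.mixin Record StarAlgebra_isCStar (R : realType) (A : Type)
    of StarAlgebra R A & CompleteNormedModule R[i] A := {
  normr_amul : forall a b : A, `|amul a b| <= `|a| * `|b|;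
  normr_star_amul : forall a : A, `|amul (star a) a| = `|a| ^+ 2
}.

#[short(type="cstarAlgType")]
HB.structure Definition CStarAlgebra (R : realType) :=
  {A of StarAlgebra_isCStar R A & StarAlgebra R A & CompleteNormedModule R[i] A}.

Section Positivity.
Context (R : realType) (A : starAlgType R).

(* The C*-algebraic order: a >= 0 iff a = c^* c for some c.                   *)
Definition star_nonneg (a : A) : Prop := exists c : A, a = amul (star c) c.

End Positivity.

(* The underlying Banach space carries the module norm |<x, x>|^(1/2), by      *)
(* normr_rip; this also makes the inner product definite.                     *)
HB.mixin Record isRightHilbertModule (R : realType) (B : cstarAlgType R)
    (X : Type) of CompleteNormedModule R[i] X := {
  ract : X -> B -> X;
  rip : X -> X -> B;
  ractA : forall x b c, ract x (amul b c) = ract (ract x b) c;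
  ractDl : forall x y b, ract (x + y) b = ract x b + ract y b;
  ractDr : forall x b c, ract x (b + c) = ract x b + ract x c;
  ractZl : forall (k : R[i]) x b, ract (k *: x) b = k *: ract x b;
  ractZr : forall (k : R[i]) x b, ract x (k *: b) = k *: ract x b;
  ripDr : forall x y z, rip x (y + z) = rip x y + rip x z;
  ripZr : forall (k : R[i]) x y, rip x (k *: y) = k *: rip x y;
  ripM : forall x y b, rip x (ract y b) = amul (rip x y) b;
  rip_star : forall x y, star (rip x y) = rip y x;
  rip_nonneg : forall x, star_nonneg (rip x x);
  normr_rip : forall x : X, `|x| ^+ 2 = `|rip x x|
}.

#[short(type="hilbertModType")]
HB.structure Definition RightHilbertModule (R : realType) (B : cstarAlgType R) :=
  {X of isRightHilbertModule R B X & CompleteNormedModule R[i] X}.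

Section Adjointable.
Context (R : realType) (B : cstarAlgType R) (X : hilbertModType B).
Implicit Types (T S : X -> X) (x y z : X).

Definition adjoint_of T S : Prop := forall x y, rip (T x) y = rip x (S y).

Lemma ripDl x y z : rip (x + y) z = rip x z + rip y z.
Proof. by rewrite -rip_star ripDr starD !rip_star. Qed.

Lemma ripZl (k : R[i]) x y : rip (k *: x) y = k^* *: rip x y.
Proof. by rewrite -rip_star ripZr starZ rip_star. Qed.

Lemma rip0l y : rip (0 : X) y = 0.
Proof. by rewrite -(scale0r (0 : X)) ripZl rmorph0 scale0r. Qed.

Lemma rip0r x : rip x 0 = 0.
Proof. by rewrite -(scale0r (0 : X)) ripZr scale0r. Qed.

Lemma ripMl x y (b : B) : rip (ract x b) y = amul (star b) (rip x y).
Proof. by rewrite -rip_star ripM starM rip_star. Qed.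

Lemma rip_eq0 x : rip x x = 0 -> x = 0.
Proof.
move=> x0; apply/eqP; rewrite -normr_eq0 -sqrf_eq0 normr_rip.
by rewrite x0 normr0.
Qed.

Lemma ripBr x y z : rip x (y - z) = rip x y - rip x z.
Proof. by rewrite ripDr -scaleN1r ripZr scaleN1r. Qed.

Lemma rip_inj x y : (forall z, rip z x = rip z y) -> x = y.
Proof.
move=> xy; apply/subr0_eq/rip_eq0.
by rewrite ripBr xy subrr.
Qed.

Lemma adjoint_of_sym T S : adjoint_of T S -> adjoint_of S T.
Proof. by move=> TS x y; rewrite -rip_star -TS rip_star. Qed.

Lemma adjoint_of_inj T S S' : adjoint_of T S -> adjoint_of T S' -> S = S'.
Proof. by move=> TS TS'; apply/funext => y; apply: rip_inj => z; rewrite -TS TS'. Qed.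

Definition adjointable_pred : {pred X -> X} := [pred T | `[< exists S, adjoint_of T S >]].

Lemma adjointable_submod : submod_closed adjointable_pred.
Proof.
split.
  apply/asboolP; exists (fun=> 0) => x y /=.
  by rewrite rip0l rip0r.
move=> k T S /asboolP[T' TT'] /asboolP[S' SS']; apply/asboolP.
exists (fun x => k^* *: T' x + S' x) => x y.
by rewrite ripDl ripZl TT' SS' ripDr ripZr.
Qed.

HB.instance Definition _ :=
  GRing.isSubmodClosed.Build R[i] (X -> X) adjointable_pred adjointable_submod.

(* L_B(X); adjointable maps are automatically linear, B-linear and bounded.   *)
Record adjointable : Type := Adjointable {
  adjointable_fun :> X -> X;
  adjointableP : adjointable_fun \in adjointable_pred
}.

HB.instance Definition _ := [isSub for adjointable_fun].
HB.instance Definition _ := [Choice of adjointable by <:].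
HB.instance Definition _ := [SubChoice_isSubLmodule of adjointable by <:].

Implicit Types U V W : adjointable.

Lemma adjointable_eq U V : (forall x, U x = V x) -> U = V.
Proof. by move=> UV; apply/val_inj/funext. Qed.

Definition mkAdjointable T S (TS : adjoint_of T S) : adjointable :=
  @Adjointable T (asboolT (ex_intro _ S TS)).

Lemma adjoint_ex U : exists S, adjoint_of U S.
Proof. by apply/asboolP/(adjointableP U). Qed.

Definition adj_fun U : X -> X := sval (cid (adjoint_ex U)).

Lemma adj_funP U : adjoint_of U (adj_fun U).
Proof. exact: svalP (cid (adjoint_ex U)). Qed.

Definition adj U : adjointable := mkAdjointable (adjoint_of_sym (@adj_funP U)).

Lemma adjP U : adjoint_of U (adj U).
Proof. exact: adj_funP. Qed.

Lemma adj_uniq U V : adjoint_of U V -> adj U = V.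
Proof.
by move=> UV; apply/val_inj; exact: adjoint_of_inj (@adjP U) UV.
Qed.

Lemma adjointable_comp_subproof U V : adjoint_of (U \o V) (adj V \o adj U).
Proof. by move=> x y /=; rewrite adjP adjP. Qed.

Definition adjointable_comp U V : adjointable :=
  mkAdjointable (@adjointable_comp_subproof U V).

Lemma adjP_sym U x y : rip (adj U x) y = rip x (U y).
Proof. exact: adjoint_of_sym (@adjP U) x y. Qed.

Lemma adjointableD U x y : U (x + y) = U x + U y.
Proof. by apply: rip_inj => z; rewrite -adjP_sym !ripDr !adjP_sym. Qed.

Lemma adjointableZ U (k : R[i]) x : U (k *: x) = k *: U x.
Proof. by apply: rip_inj => z; rewrite -adjP_sym !ripZr adjP_sym. Qed.

Lemma adjointable_addE U V x : (U + V) x = U x + V x.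
Proof. by []. Qed.

Lemma adjointable_scaleE (k : R[i]) U x : (k *: U) x = k *: U x.
Proof. by []. Qed.

Lemma adjointable_compA U V W :
  adjointable_comp U (adjointable_comp V W) =
  adjointable_comp (adjointable_comp U V) W.
Proof. exact: adjointable_eq. Qed.

Lemma adjointable_compDl U V W :
  adjointable_comp (U + V) W = adjointable_comp U W + adjointable_comp V W.
Proof. exact: adjointable_eq. Qed.

Lemma adjointable_compDr U V W :
  adjointable_comp U (V + W) = adjointable_comp U V + adjointable_comp U W.
Proof. by apply: adjointable_eq => x; exact: adjointableD. Qed.

Lemma adjointable_compZl (k : R[i]) U V :
  adjointable_comp (k *: U) V = k *: adjointable_comp U V.
Proof. exact: adjointable_eq. Qed.

Lemma adjointable_compZr (k : R[i]) U V :
  adjointable_comp U (k *: V) = k *: adjointable_comp U V.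
Proof. by apply: adjointable_eq => x; exact: adjointableZ. Qed.

Lemma adjD U V : adj (U + V) = adj U + adj V.
Proof.
by apply: adj_uniq => x y; rewrite !adjointable_addE ripDl ripDr !adjP.
Qed.

Lemma adjZ (k : R[i]) U : adj (k *: U) = k^* *: adj U.
Proof.
by apply: adj_uniq => x y; rewrite !adjointable_scaleE ripZl ripZr adjP.
Qed.

Lemma adj_comp U V :
  adj (adjointable_comp U V) = adjointable_comp (adj V) (adj U).
Proof. by apply: adj_uniq => x y; exact: adjointable_comp_subproof. Qed.

Lemma adjK U : adj (adj U) = U.
Proof. by apply: adj_uniq; exact: adjP_sym. Qed.

HB.instance Definition _ := Lmodule_isStarAlgebra.Build R adjointable
  adjointable_compA adjointable_compDl adjointable_compDr adjointable_compZl
  adjointable_compZr adjD adjZ adj_comp adjK.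

(* Valued in \bar R, so that no boundedness proof is needed to define it.      *)
Definition opnorm U : \bar R :=
  ereal_sup [set (complex.Re `|U x|)%:E | x in [set x | `|x| <= 1]].

Lemma theta_adjoint x y :
  adjoint_of (fun z => ract x (rip y z)) (fun z => ract y (rip x z)).
Proof. by move=> z w; rewrite ripMl ripM rip_star. Qed.

Definition theta x y : adjointable := mkAdjointable (@theta_adjoint x y).

Definition finite_rank : set adjointable :=
  [set U : adjointable | exists n (c : 'I_n -> R[i]) (x y : 'I_n -> X),
     U = \sum_(i < n) c i *: theta (x i) (y i)].

(* The operator-norm closure of the span of the theta x y.                    *)
Definition compact_maps : set adjointable :=
  [set U : adjointable | forall e : R, 0 < e ->
     exists2 V, finite_rank V & (opnorm (U - V)%R < e%:E)%E].

End Adjointable.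

Arguments compact_maps {R B} X _.

HB.mixin Record isStarMultiplicative (R : realType) (A A' : starAlgType R)
    (f : A -> A') := {
  starhomM : forall a b, f (amul a b) = amul (f a) (f b);
  starhom_star : forall a, f (star a) = star (f a)
}.

HB.structure Definition StarHom (R : realType) (A A' : starAlgType R) :=
  {f of isStarMultiplicative R A A' f & @GRing.Linear R[i] A A' *:%R f}.

Notation "{ 'starhom' A -> B }" := (StarHom.type A B)
  (at level 0, A at level 98, B at level 99, format "{ 'starhom'  A  ->  B }")
  : type_scope.

Section Coimage.
Local Open Scope quotient_scope.
Context (R : realType) (A : cstarAlgType R) (A' : starAlgType R).
Context (f : {starhom A -> A'}).
Implicit Types (a b c : A) (k : R[i]).

Definition hom_kernel : {pred A} := [pred a | f a == 0].

Lemma hom_kernel_zmod : zmod_closed hom_kernel.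
Proof.
split=> [|a b]; first by rewrite inE raddf0.
by rewrite !inE raddfB /= => /eqP -> /eqP ->; rewrite subrr.
Qed.

HB.instance Definition _ := GRing.isZmodClosed.Build A hom_kernel hom_kernel_zmod.

(* A / ker f, with the operations inherited from A.                           *)
Definition coimage : Type := Quotient.quot (hom_kernel : zmodClosed A).

HB.instance Definition _ := EqQuotient.on coimage.
HB.instance Definition _ := GRing.Zmodule.on coimage.

Definition coproj a : coimage := \pi_coimage a.

Lemma coprojP a b : coproj a = coproj b <-> f a = f b.
Proof.
split=> [/eqP|ab].
  by rewrite -Quotient.idealrBE inE raddfB /= subr_eq0 => /eqP.
by apply/eqP; rewrite -Quotient.idealrBE inE raddfB /= ab subrr.
Qed.

Lemma coproj_reprE a : f (repr (coproj a)) = f a.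
Proof. by apply/coprojP; rewrite /coproj reprK. Qed.

Lemma coprojK (u : coimage) : coproj (repr u) = u.
Proof. exact: reprK. Qed.

Lemma coprojD a b : coproj (a + b) = coproj a + coproj b.
Proof. by rewrite /coproj !piE. Qed.

Definition coscale k (u : coimage) := coproj (k *: repr u).
Definition coamul (u v : coimage) := coproj (amul (repr u) (repr v)).
Definition costar (u : coimage) := coproj (star (repr u)).

Lemma coproj_scale k a : coscale k (coproj a) = coproj (k *: a).
Proof. by apply/coprojP; rewrite !linearZ /= coproj_reprE. Qed.

Lemma coproj_amul a b : coamul (coproj a) (coproj b) = coproj (amul a b).
Proof. by apply/coprojP; rewrite !starhomM !coproj_reprE. Qed.

Lemma coproj_star a : costar (coproj a) = coproj (star a).
Proof. by apply/coprojP; rewrite !starhom_star coproj_reprE. Qed.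

Lemma coimageW (P : coimage -> Prop) : (forall a, P (coproj a)) -> forall u, P u.
Proof. by move=> Pa u; rewrite -(coprojK u). Qed.

Lemma coscaleA k l u : coscale k (coscale l u) = coscale (k * l) u.
Proof. by elim/coimageW: u => a; rewrite !coproj_scale scalerA. Qed.

Lemma coscale1 : left_id 1 coscale.
Proof. by elim/coimageW => a; rewrite !coproj_scale scale1r. Qed.

Lemma coscaleDr : right_distributive coscale +%R.
Proof.
move=> k; elim/coimageW => a; elim/coimageW => b.
by rewrite -coprojD !coproj_scale -coprojD scalerDr.
Qed.

Lemma coscaleDl u : {morph coscale^~ u : k l / k + l}.
Proof.
by elim/coimageW: u => a k l; rewrite !coproj_scale -coprojD scalerDl.
Qed.

HB.instance Definition _ := GRing.Zmodule_isLmodule.Build R[i] coimage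
  coscaleA coscale1 coscaleDr coscaleDl.

Lemma coprojZ k a : coproj (k *: a) = k *: coproj a.
Proof. by rewrite -coproj_scale. Qed.

Lemma coamulA u v w : coamul u (coamul v w) = coamul (coamul u v) w.
Proof.
elim/coimageW: u => a; elim/coimageW: v => b; elim/coimageW: w => c.
by rewrite !coproj_amul amulA.
Qed.

Lemma coamulDl u v w : coamul (u + v) w = coamul u w + coamul v w.
Proof.
elim/coimageW: u => a; elim/coimageW: v => b; elim/coimageW: w => c.
by rewrite -(coprojD a b) !coproj_amul amulDl coprojD.
Qed.

Lemma coamulDr u v w : coamul u (v + w) = coamul u v + coamul u w.
Proof.
elim/coimageW: u => a; elim/coimageW: v => b; elim/coimageW: w => c.
by rewrite -(coprojD b c) !coproj_amul amulDr coprojD.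
Qed.

Lemma coamulZl k u v : coamul (k *: u) v = k *: coamul u v.
Proof.
elim/coimageW: u => a; elim/coimageW: v => b.
by rewrite -(coprojZ k a) !coproj_amul amulZl coprojZ.
Qed.

Lemma coamulZr k u v : coamul u (k *: v) = k *: coamul u v.
Proof.
elim/coimageW: u => a; elim/coimageW: v => b.
by rewrite -(coprojZ k b) !coproj_amul amulZr coprojZ.
Qed.

Lemma costarD u v : costar (u + v) = costar u + costar v.
Proof.
elim/coimageW: u => a; elim/coimageW: v => b.
by rewrite -(coprojD a b) !coproj_star starD coprojD.
Qed.

Lemma costarZ k u : costar (k *: u) = k^* *: costar u.
Proof.
by elim/coimageW: u => a; rewrite -(coprojZ k a) !coproj_star starZ coprojZ.
Qed.

Lemma costarM u v : costar (coamul u v) = coamul (costar v) (costar u).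
Proof.
elim/coimageW: u => a; elim/coimageW: v => b.
by rewrite (coproj_amul a b) !coproj_star coproj_amul starM.
Qed.

Lemma costarK u : costar (costar u) = u.
Proof. by elim/coimageW: u => a; rewrite !coproj_star starK. Qed.

HB.instance Definition _ := Lmodule_isStarAlgebra.Build R coimage
  coamulA coamulDl coamulDr coamulZl coamulZr costarD costarZ costarM costarK.

Lemma coprojM a b : coproj (amul a b) = amul (coproj a) (coproj b).
Proof. by rewrite -coproj_amul. Qed.

Lemma coproj_starE a : coproj (star a) = star (coproj a).
Proof. by rewrite -coproj_star. Qed.

Definition quotient_norm (u : coimage) : R :=
  inf [set complex.Re `|a| | a in [set a | coproj a = u]].

Definition induced_hom (u : coimage) : A' := f (repr u).

Lemma induced_hom_coproj a : induced_hom (coproj a) = f a.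
Proof. exact: coproj_reprE. Qed.

Lemma induced_hom_inj : injective induced_hom.
Proof.
elim/coimageW => a; elim/coimageW => b.
by rewrite !induced_hom_coproj => /coprojP.
Qed.

Lemma induced_hom_linear : linear induced_hom.
Proof.
move=> k; elim/coimageW => a; elim/coimageW => b.
by rewrite -coprojZ -coprojD !induced_hom_coproj linearP.
Qed.

Lemma induced_homM u v : induced_hom (amul u v) = amul (induced_hom u) (induced_hom v).
Proof.
elim/coimageW: u => a; elim/coimageW: v => b.
by rewrite -coprojM !induced_hom_coproj starhomM.
Qed.

Lemma induced_hom_star u : induced_hom (star u) = star (induced_hom u).
Proof.
by elim/coimageW: u => a; rewrite -coproj_starE !induced_hom_coproj starhom_star.
Qed.

HB.instance Definition _ :=
  @GRing.isLinear.Build R[i] coimage A' *:%R induced_hom induced_hom_linear.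
HB.instance Definition _ :=
  isStarMultiplicative.Build R coimage A' induced_hom induced_homM induced_hom_star.

End Coimage.

Arguments coimage {R A A'} f.
Arguments quotient_norm {R A A'} f u.
Arguments induced_hom {R A A'} f u.

(* Left Hilbert D-modules only use the *-algebra D and its norm normD. The    *)
(* norm is an argument so that D can be A / ker f with the quotient norm,     *)
(* which is a C*-algebra by a theorem that is not proved here.                *)
Section HilbertBimodule.
Context (R : realType) (D : starAlgType R) (normD : D -> R).
Implicit Types (a b : D) (k : R[i]).

Definition complete_for (V : lmodType R[i]) (N : V -> R) : Prop :=
  forall u : nat -> V,
    (forall e : R, 0 < e -> exists n0 : nat, forall m n : nat,
       (n0 <= m)%N -> (n0 <= n)%N -> N (u m - u n) < e) ->
    exists l : V, forall e : R, 0 < e ->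
      exists n0 : nat, forall n : nat, (n0 <= n)%N -> N (u n - l) < e.

Record left_hilbert_module (X : lmodType R[i])
    (lact : D -> X -> X) (lip : X -> X -> D) : Prop := {
  lactA : forall a b x, lact (amul a b) x = lact a (lact b x);
  lactDl : forall a b x, lact (a + b) x = lact a x + lact b x;
  lactDr : forall a x y, lact a (x + y) = lact a x + lact a y;
  lactZl : forall k a x, lact (k *: a) x = k *: lact a x;
  lactZr : forall k a x, lact a (k *: x) = k *: lact a x;
  lipDl : forall x y z, lip (x + y) z = lip x z + lip y z;
  lipZl : forall k x y, lip (k *: x) y = k *: lip x y;
  lipM : forall a x y, lip (lact a x) y = amul a (lip x y);
  lip_star : forall x y, star (lip x y) = lip y x;
  lip_nonneg : forall x, star_nonneg (lip x x);
  lip_eq0 : forall x, lip x x = 0 -> x = 0;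
  lip_complete : complete_for (fun x => Num.sqrt (normD (lip x x)))
}.

(* The right Hilbert module structure is that of X; lact and lip are the left *)
(* action and the left inner product.                                         *)
Definition hilbert_bimodule (B : cstarAlgType R) (X : hilbertModType B)
    (lact : D -> X -> X) (lip : X -> X -> D) : Prop :=
  left_hilbert_module lact lip /\
  forall x y z, lact (lip x y) z = ract x (rip y z).

End HilbertBimodule.

(* Main.v *)
(* If lip makes X a bimodule, then phi_0 (lip x y) = theta x y, so lip is      *)
(* unique and the range of phi contains the finite rank maps. The range is    *)
(* closed: for selfadjoint a, the element a / (1 + a^2) of A has norm at most *)
(* |phi a| / 2 after rescaling by |phi a|, and its image is within            *)
(* |phi a| / 2 of phi a, so that iterating lifts phi a to an element of norm  *)
(* at most |phi a|. All norm bounds for functions of a selfadjoint a come     *)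
(* from one remark: if P and Q are commuting selfadjoint maps and             *)
(* P^2 + Q^2 = t^2, then P + i Q is t times an isometry, hence |P| <= t.      *)
(*   Conversely, phi_0^-1 (theta x y) is a left inner product. Completeness   *)
(* follows from the same lifting. For positivity, let theta x x = phi a,      *)
(* m = |a|, r = sqrt m and n = m - a; then y = phi n x satisfies              *)
(* <y, y>^2 = - <phi (r n) y, phi (r n) y>, which forces y = 0 by             *)
(* Kaplansky's argument that -p^* p is never a nonzero square, so that        *)
(* theta x x = phi (r)^2.                                                     *)

Require Import Defs.
From HB Require Import structures.
From mathcomp Require Import all_boot all_order all_algebra.
From mathcomp Require Import complex ring lra.
From mathcomp Require Import all_classical all_reals all_analysis.

Set Implicit Arguments.
Unset Strict Implicit.
Unset Printing Implicit Defensive.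

Import Order.TTheory GRing.Theory Num.Theory numFieldNormedType.Exports.

Local Open Scope classical_set_scope.
Local Open Scope complex_scope.
Local Open Scope ring_scope.

(** The bimodule identity says that the induced map phi_0 sends the left inner product of x and y to
    [theta x y]. As phi_0 is injective, there is only one candidate, and it can be defined exactly
    when phi attains every [theta x y].

    A bimodule therefore puts the finite rank maps in the range of phi, and [range_closed] adds
    their limits. The point is to lift with control of the norm: a self-adjoint element whose image
    has norm at most r is truncated to one of norm at most r/2 whose image is within r/2
    ([approximate_lift]); lifting the errors again gives a geometric series ([selfadjoint_range]).

    Conversely, the algebraic axioms for [left_rip] are identities between the maps [theta x y],
    pulled back along phi_0. Two axioms need analysis. Positivity asks that the preimage of
    [theta x x] be a square; this is [theta_sqrt], resting on [positive_sqrt] and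
    [star_amul_neg_square]. Completeness holds because the controlled lift makes the new norm
    equivalent to that of X ([quotient_norm_left_rip]).

    Square roots and resolvents are limits of iterations in A; the norm inequality |t^2 - y| <= t^2
    stands for the positivity of y, and the scalar part of the unitization is carried separately.
    The constants are not sharp, since only equivalence of norms matters. *)

(** * Linear identities in a module, by reflection *)

Inductive lin_expr (K : Type) : Type :=
| LinAtom of nat
| LinZero
| LinAdd of lin_expr K & lin_expr K
| LinOpp of lin_expr K
| LinScale of K & lin_expr K.
Arguments LinAtom {K}.
Arguments LinZero {K}.

Section LinearExpressions.
Context (K : pzRingType) (V : lmodType K).
Implicit Types (env : seq V) (e : lin_expr K).

Fixpoint lin_eval env e : V :=
  match e with
  | LinAtom n => env`_n
  | LinZero => 0
  | LinAdd e1 e2 => lin_eval env e1 + lin_eval env e2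
  | LinOpp e1 => - lin_eval env e1
  | LinScale k e1 => k *: lin_eval env e1
  end.

Fixpoint lin_coef (n : nat) e : K :=
  match e with
  | LinAtom m => if m == n then 1 else 0
  | LinZero => 0
  | LinAdd e1 e2 => lin_coef n e1 + lin_coef n e2
  | LinOpp e1 => - lin_coef n e1
  | LinScale k e1 => k * lin_coef n e1
  end.

(** A recursive conjunction rather than a quantifier over indices: on a concrete environment it
    unfolds to finitely many ring equations. *)
Fixpoint lin_same_coefs (n : nat) e1 e2 : Prop :=
  match n with
  | 0 => True
  | m.+1 => lin_coef m e1 = lin_coef m e2 /\ lin_same_coefs m e1 e2
  end.

Lemma lin_evalE env e :
  lin_eval env e = \sum_(i < size env) lin_coef i e *: env`_i.
Proof.
elim: e => [n||e1 IH1 e2 IH2|e1 IH1|k e1 IH1] /=.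
- have [nlt|nge] := ltnP n (size env).
    rewrite (bigD1 (Ordinal nlt)) //= eqxx scale1r big1 ?addr0// => i.
    by rewrite -val_eqE /= eq_sym => /negPf ->; rewrite scale0r.
  rewrite nth_default // big1 // => i _.
  by rewrite gtn_eqF ?scale0r // (leq_trans (ltn_ord i)).
- by rewrite big1 // => i _; rewrite scale0r.
- by rewrite IH1 IH2 -big_split /=; apply: eq_bigr => i _; rewrite scalerDl.
- by rewrite IH1 -sumrN; apply: eq_bigr => i _; rewrite scaleNr.
- by rewrite IH1 scaler_sumr; apply: eq_bigr => i _; rewrite scalerA.
Qed.

Lemma lin_eval_eq env e1 e2 :
  lin_same_coefs (size env) e1 e2 -> lin_eval env e1 = lin_eval env e2.
Proof.
rewrite !lin_evalE => same; apply: eq_bigr => i _; congr (_ *: _).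
have same_lt n : lin_same_coefs n e1 e2 ->
    forall m, (m < n)%N -> lin_coef m e1 = lin_coef m e2.
  elim: n => // n IH [same_n /IH same_lt] m.
  by rewrite ltnS leq_eqVlt => /predU1P[-> //|/same_lt].
exact: same_lt same i (ltn_ord i).
Qed.

End LinearExpressions.

Ltac lin_lookup x env :=
  lazymatch env with
  | x :: _ => constr:(0%N)
  | _ :: ?env' => let n := lin_lookup x env' in constr:(n.+1)
  end.

(** The first branch fails when [x] is not yet listed; [match] then backtracks to the second. *)
Ltac lin_insert x env :=
  match env with
  | _ => let n := lin_lookup x env in env
  | _ => constr:(x :: env)
  end.

Ltac lin_atoms e env :=
  lazymatch e with
  | 0 => env
  | ?a + ?b => let env1 := lin_atoms b env in lin_atoms a env1
  | - ?a => lin_atoms a env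
  | ?k *: ?a => lin_atoms a env
  | _ => lin_insert e env
  end.

Ltac lin_reify K e env :=
  lazymatch e with
  | 0 => constr:(@LinZero K)
  | ?a + ?b =>
    let ea := lin_reify K a env in let eb := lin_reify K b env in
    constr:(@LinAdd K ea eb)
  | - ?a => let ea := lin_reify K a env in constr:(@LinOpp K ea)
  | ?k *: ?a => let ea := lin_reify K a env in constr:(@LinScale K k ea)
  | _ => let n := lin_lookup e env in constr:(@LinAtom K n)
  end.

(* Reduces an identity between linear combinations to the equality of the     *)
(* coefficients of each atom.                                                 *)
Ltac lin_coefs K :=
  lazymatch goal with
  | |- ?l = ?r :> ?V =>
    let env0 := lin_atoms r (@nil V) in
    let env := lin_atoms l env0 in
    let el := lin_reify K l env in
    let er := lin_reify K r env in
    apply: (@lin_eval_eq _ _ env el er); rewrite /=;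
    repeat match goal with |- _ /\ _ => split | |- True => exact: I end
  end.

Ltac lin_comb K := by lin_coefs K; first [ring | field].


(** * Real-valued norms, convergence and completeness *)

Section RealNorm.
Context (R : realType) (V : normedModType R[i]).
Implicit Types (x y z : V) (k : R[i]) (t : R).

(** Norms take values in R[i]; the real part moves them to R, where [lra] and [nra] apply. *)
Definition nrm x : R := complex.Re `|x|.

Lemma nrmE x : `|x| = (nrm x)%:C.
Proof. by rewrite /nrm RRe_real // normr_real. Qed.

Lemma nrm_ge0 x : 0 <= nrm x.
Proof. by rewrite -ler0c -nrmE. Qed.

Lemma nrm0 : nrm 0 = 0.
Proof. by rewrite /nrm normr0. Qed.

Lemma nrm_eq0 x : nrm x = 0 -> x = 0.
Proof. by move=> x0; apply/eqP; rewrite -normr_eq0 nrmE x0. Qed.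

Lemma nrmD x y : nrm (x + y) <= nrm x + nrm y.
Proof. by rewrite -lecR rmorphD /= -!nrmE ler_normD. Qed.

Lemma nrmN x : nrm (- x) = nrm x.
Proof. by rewrite /nrm normrN. Qed.

Lemma nrm_sub x y : nrm (x - y) = nrm (y - x).
Proof. by rewrite /nrm distrC. Qed.

Lemma nrmB x y : nrm (x - y) <= nrm x + nrm y.
Proof. by rewrite -[nrm y]nrmN nrmD. Qed.

Lemma nrmZ k x : nrm (k *: x) = complex.Re `|k| * nrm x.
Proof.
rewrite {1}/nrm normrZ nrmE -[`|k|]RRe_real ?normr_real //.
by rewrite -rmorphM.
Qed.

Lemma nrmZr t x : nrm (t%:C *: x) = `|t| * nrm x.
Proof. by rewrite nrmZ normc_def /= expr0n addr0 sqrtr_sqr. Qed.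

Lemma nrmZi x : nrm ('i *: x) = nrm x.
Proof. by rewrite nrmZ normCi mul1r. Qed.

Lemma cvg_nrmP (u : nat -> V) (l : V) :
  u @ \oo --> l <->
  forall e : R, 0 < e -> exists n0 : nat, forall n, (n0 <= n)%N -> nrm (u n - l) < e.
Proof.
split=> [/cvgrPdistC_lt ul e e0|ul].
  have [|n0 _ n0P] := ul e%:C; first by rewrite (ltcR 0).
  by exists n0 => n /n0P /=; rewrite nrmE ltcR.
apply/cvgrPdistC_lt => e e0.
have eE : e = (complex.Re e)%:C by rewrite RRe_real // gtr0_real.
have [|n0 n0P] := ul (complex.Re e); first by rewrite -(ltcR 0) -eE.
by exists n0 => // n /= /n0P; rewrite eE nrmE ltcR.
Qed.

Lemma cvg_nrm_le (u : nat -> V) (l : V) (r : R) :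
  u @ \oo --> l -> (forall n, nrm (u n) <= r) -> nrm l <= r.
Proof.
move=> /cvg_nrmP ul ur; apply/ler_addgt0Pr => e e0.
have [n /(_ n (leqnn n)) une] := ul e e0.
have := nrmD (u n) (l - u n); rewrite subrKC nrm_sub.
by have := ur n; lra.
Qed.

End RealNorm.

Section Completeness.
Context (R : realType) (V : completeNormedModType R[i]).

Lemma nrm_complete : complete_for (@nrm R V).
Proof.
move=> u u_cauchy.
suff /cvg_ex[l /cvg_nrmP ul] : cvgn u by exists l.
apply/cauchy_cvgP/cauchy_ballP => e e0.
have eE : e = (complex.Re e)%:C by rewrite RRe_real // gtr0_real.
have [|n0 n0P] := u_cauchy (complex.Re e); first by rewrite -(ltcR 0) -eE.
exists ([set u n | n in [set n | (n0 <= n)%N]],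
        [set u n | n in [set n | (n0 <= n)%N]])
  => [|_ [[m /= n0m <-] [n /= n0n <-]]] /=.
  by split; exists n0 => // n n0n; exists n.
by rewrite -ball_normE /= eE nrmE ltcR; exact: n0P.
Qed.

(** Method of majorants: [s] is nondecreasing and bounded, hence Cauchy, and its increments dominate
    the distances between terms of [u]. *)
Lemma cvg_majorant (u : nat -> V) (s : nat -> R) (M : R) :
  (forall n, nrm (u n.+1 - u n) <= s n.+1 - s n) -> (forall n, s n <= M) ->
  cvgn u.
Proof.
move=> us sM.
have dist m n : (m <= n)%N -> nrm (u n - u m) <= s n - s m.
  elim: n => [|n IH]; first by rewrite leqn0 => /eqP ->; rewrite !subrr nrm0.
  rewrite leq_eqVlt => /predU1P[->|/IH mn]; first by rewrite !subrr nrm0.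
  have := nrmD (u n.+1 - u n) (u n - u m); rewrite subrKA.
  by have := us n; lra.
have sup_s : has_sup (range s).
  by split; [exists (s 0%N), 0%N | exists M => _ [n _ <-]].
suff [l /cvg_nrmP ul] : exists l, forall e : R, 0 < e ->
    exists n0 : nat, forall n, (n0 <= n)%N -> nrm (u n - l) < e.
  by apply/cvg_ex; exists l.
apply: nrm_complete => e e0.
have [_ [n0 _ <-] n0P] := sup_adherent (divr_gt0 e0 (ltr0Sn R 1)) sup_s.
have s_le n : s n <= sup (range s) by apply: ub_le_sup; [case: sup_s|exists n].
exists n0 => m n n0m n0n.
have := nrmD (u m - u n0) (u n0 - u n); rewrite subrKA [nrm (u n0 - _)]nrm_sub.
by move: (dist _ _ n0m) (dist _ _ n0n) (s_le m) (s_le n); lra.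
Qed.

End Completeness.

(** * Algebra and norm of a C*-algebra *)

Section StarAlgebra.
Context (R : realType) (A : starAlgType R).
Implicit Types (a b : A) (k : R[i]).

Lemma amul0l a : amul 0 a = 0.
Proof. by rewrite -(scale0r (0 : A)) amulZl !scale0r. Qed.

Lemma amul0r a : amul a 0 = 0.
Proof. by rewrite -(scale0r (0 : A)) amulZr !scale0r. Qed.

Lemma amulNl a b : amul (- a) b = - amul a b.
Proof. by rewrite -scaleN1r amulZl scaleN1r. Qed.

Lemma amulNr a b : amul a (- b) = - amul a b.
Proof. by rewrite -scaleN1r amulZr scaleN1r. Qed.

Lemma conjCr (t : R) : (t%:C)^* = t%:C :> R[i].
Proof. exact: conjc_real. Qed.

Lemma starZr (t : R) a : star (t%:C *: a) = t%:C *: star a.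
Proof. by rewrite starZ conjCr. Qed.

Lemma star0 : star (0 : A) = 0.
Proof. by rewrite -(scale0r (0 : A)) starZ rmorph0 !scale0r. Qed.

Lemma starN a : star (- a) = - star a.
Proof. by rewrite -scaleN1r starZ rmorphN rmorph1 scaleN1r. Qed.

Definition re_part a : A := 2^-1%:C *: (a + star a).
Definition im_part a : A := 2^-1%:C *: ('i *: (star a - a)).

Lemma re_partS a : star (re_part a) = re_part a.
Proof. by rewrite /re_part starZr starD starK addrC. Qed.

Lemma im_partS a : star (im_part a) = im_part a.
Proof.
by rewrite /im_part starZr starZ starD starN starK conjCi; lin_comb R[i].
Qed.

Lemma re_im_partE a : a = re_part a + 'i *: im_part a.
Proof.
have i2 : 'i * 'i = -1 :> R[i] by rewrite -expr2 sqrCi.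
have h2 : 2^-1%:C + 2^-1%:C = 1 :> R[i] by field.
by rewrite /re_part /im_part; lin_coefs R[i]; ring: i2 h2.
Qed.

End StarAlgebra.

Section CStarNorm.
Context (R : realType) (A : cstarAlgType R).
Implicit Types (a b : A) (k : R[i]).

Lemma nrm_amul a b : nrm (amul a b) <= nrm a * nrm b.
Proof. by rewrite -lecR rmorphM /= -!nrmE normr_amul. Qed.

Lemma nrm_star_amul a : nrm (amul (star a) a) = nrm a ^+ 2.
Proof. by apply: complexI; rewrite rmorphXn /= -!nrmE normr_star_amul. Qed.

Lemma nrm_star a : nrm (star a) = nrm a.
Proof.
have star_le b : nrm b <= nrm (star b).
  have [-> | /eqP b0] := eqVneq b 0; first by rewrite nrm0 nrm_ge0.
  have b_gt0 : 0 < nrm b by rewrite lt0r nrm_ge0 andbT; apply/eqP => /nrm_eq0.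
  rewrite -(ler_pM2r b_gt0) -expr2 -nrm_star_amul; exact: nrm_amul.
by apply/le_anti; rewrite star_le -{2}(starK a) star_le.
Qed.

(** Testing at z = [star a] gives |a|^2 <= r |a|. Bounds on left multiplication by [a] thus become
    bounds on [a]. *)
Lemma nrm_le_of_mul a (r : R) :
  0 <= r -> (forall z, nrm (amul a z) <= r * nrm z) -> nrm a <= r.
Proof.
move=> r0 /(_ (star a)); rewrite -{1}(starK a) nrm_star_amul nrm_star => ar.
have [-> | /eqP a0] := eqVneq a 0; first by rewrite nrm0.
have a_gt0 : 0 < nrm a by rewrite lt0r nrm_ge0 andbT; apply/eqP => /nrm_eq0.
by rewrite -(ler_pM2r a_gt0) -expr2.
Qed.

Lemma cvg_amul (u v : nat -> A) a b :
  u @ \oo --> a -> v @ \oo --> b -> (fun n => amul (u n) (v n)) @ \oo --> amul a b.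
Proof.
move=> /cvg_nrmP ua /cvg_nrmP vb; apply/cvg_nrmP => e e0.
pose M := nrm a + nrm b + 1.
have M0 : 0 < M by rewrite /M; move: (nrm_ge0 a) (nrm_ge0 b); lra.
(* The bound 1 gives |v n| <= |b| + 1, so the two error terms add up to at most d M <= e / 2. *)
pose d := Num.min 1 (e / (2 * M)).
have d0 : 0 < d by rewrite lt_min ltr01 divr_gt0 // mulr_gt0.
have [n1 ua1] := ua d d0; have [n2 vb2] := vb d d0.
exists (maxn n1 n2) => n; rewrite geq_max => /andP[/ua1 ua1n /vb2 vb2n].
have -> : amul (u n) (v n) - amul a b =
    amul (u n - a) (v n) + amul a (v n - b).
  by rewrite amulDl amulDr amulNl amulNr; lin_comb R[i].
have d1 : d <= 1 by rewrite /d ge_min lexx.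
have dM : d * (2 * M) <= e by rewrite -ler_pdivlMr ?mulr_gt0 // /d ge_min lexx orbT.
have vM : nrm (v n) <= nrm b + 1.
  by have := nrmD (v n - b) b; rewrite subrK; lra.
apply: le_lt_trans (nrmD _ _) _.
have := nrm_amul (u n - a) (v n); have := nrm_amul a (v n - b).
move: (nrm_ge0 (u n - a)) (nrm_ge0 (v n)) (nrm_ge0 a) (nrm_ge0 (v n - b)) (nrm_ge0 b).
rewrite /M in dM M0 *; nra.
Qed.

Lemma cvg_star (u : nat -> A) a :
  u @ \oo --> a -> (fun n => star (u n)) @ \oo --> star a.
Proof.
move=> /cvg_nrmP ua; apply/cvg_nrmP => e /ua[n0 n0P].
by exists n0 => n /n0P; rewrite -nrm_star starD starN.
Qed.

End CStarNorm.

(** * Norm estimates in a Hilbert module and for maps on it *)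

Section HilbertModuleNorm.
Context (R : realType) (B : cstarAlgType R) (X : hilbertModType B).
Implicit Types (x y z v w : X) (b : B) (k : R[i]).

Lemma ripNl x y : rip (- x) y = - rip x y.
Proof. by rewrite -scaleN1r ripZl rmorphN rmorph1 scaleN1r. Qed.

Lemma ripNr x y : rip x (- y) = - rip x y.
Proof. by rewrite -scaleN1r ripZr scaleN1r. Qed.

Lemma nrm_rip x : nrm x ^+ 2 = nrm (rip x x).
Proof. by apply: complexI; rewrite rmorphXn /= -!nrmE normr_rip. Qed.

Lemma nrm_ract x b : nrm (ract x b) <= nrm x * nrm b.
Proof.
rewrite -(@ler_pXn2r _ 2) ?nnegrE ?mulr_ge0 ?nrm_ge0 //.
rewrite exprMn !nrm_rip ripMl ripM; apply: le_trans (nrm_amul _ _) _.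
rewrite nrm_star; have := nrm_amul (rip x x) b.
by have := nrm_ge0 b; nra.
Qed.

Lemma rip_polar x y :
  4%:C *: rip x y = rip (x + y) (x + y) - rip (x - y) (x - y)
    - 'i *: rip (x + 'i *: y) (x + 'i *: y) + 'i *: rip (x - 'i *: y) (x - 'i *: y).
Proof.
rewrite !(ripDl, ripDr, ripNl, ripNr, ripZl, ripZr) conjCi.
have i2 : 'i * 'i = -1 :> R[i] by rewrite -expr2 sqrCi.
by lin_coefs R[i]; ring: i2.
Qed.

(* Polarisation gives the Cauchy-Schwarz inequality up to the factor 4, which *)
(* is enough here and does not require the order of B.                        *)
Lemma nrm_rip_le x y : nrm (rip x y) <= 4 * nrm x * nrm y.
Proof.
have small z w : nrm z <= 1 -> nrm w <= 1 -> nrm (rip z w) <= 4.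
  move=> z1 w1.
  have sq v : nrm v <= 2 -> nrm (rip v v) <= 4.
    by move=> v2; rewrite -nrm_rip; have := nrm_ge0 v; nra.
  have zw v : nrm v <= 1 -> nrm (rip (z + v) (z + v)) <= 4.
    by move=> v1; apply: sq; have := nrmD z v; lra.
  have : nrm (4%:C *: rip z w) <= 16.
    have := zw w w1; have := zw (- w); rewrite nrmN => /(_ w1).
    have := zw ('i *: w); rewrite nrmZi => /(_ w1).
    have := zw (- ('i *: w)); rewrite nrmN nrmZi => /(_ w1).
    rewrite rip_polar; set p := rip (z + w) _; set q := rip (z - w) _.
    set p' := rip (z + 'i *: w) _; set q' := rip (z - 'i *: w) _.
    have := nrmD (p - q - 'i *: p') ('i *: q'); have := nrmB (p - q) ('i *: p').
    by have := nrmB p q; rewrite !nrmZi; lra.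
  by rewrite nrmZr ger0_norm // ; lra.
have [-> | /eqP x0] := eqVneq x 0; first by rewrite rip0l !nrm0 mulr0 mul0r.
have [-> | /eqP y0] := eqVneq y 0; first by rewrite rip0r !nrm0 mulr0.
have x_gt0 : 0 < nrm x by rewrite lt0r nrm_ge0 andbT; apply/eqP => /nrm_eq0.
have y_gt0 : 0 < nrm y by rewrite lt0r nrm_ge0 andbT; apply/eqP => /nrm_eq0.
have := small ((nrm x)^-1%:C *: x) ((nrm y)^-1%:C *: y).
rewrite ripZl ripZr conjCr !nrmZr !ger0_norm ?invr_ge0 ?nrm_ge0 //.
rewrite !mulVf ?gt_eqF // => /(_ (lexx _) (lexx _)).
rewrite !ler_pdivrMl // => xy.
by have -> : 4 * nrm x * nrm y = nrm y * (nrm x * 4) by ring.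
Qed.

Lemma nrm_le_of_rip (x : X) (r : R) : 0 <= r -> nrm (rip x x) <= r ^+ 2 -> nrm x <= r.
Proof. by move=> r0; rewrite -nrm_rip ler_pXn2r ?nnegrE ?nrm_ge0. Qed.

Lemma nrm_theta_le x y z : nrm (theta x y z) <= 4 * nrm x * nrm y * nrm z.
Proof.
rewrite /=; apply: le_trans (nrm_ract _ _) _.
by have := (nrm_rip_le y z); have := nrm_ge0 x; nra.
Qed.

(** The vector x is itself the test: with b = <x, x>, [theta x x] maps x to x b, and |x b|^2 =
    |b^3|. The C*-identity gives |b|^4 = |b^4| <= |b| |b^3|, hence |b| <= r. *)
Lemma nrm_theta_ge x (r : R) :
  0 <= r -> (forall z, nrm (theta x x z) <= r * nrm z) -> nrm x ^+ 2 <= r.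
Proof.
move=> r0 /(_ x) /=; set b := rip x x => xr.
have bb : star b = b by rewrite rip_star.
have b4 : (nrm b ^+ 2) ^+ 2 <= nrm b * nrm (ract x b) ^+ 2.
  rewrite -{1}nrm_star_amul bb -nrm_star_amul starM bb nrm_rip ripMl ripM bb -/b.
  by rewrite -amulA; exact: nrm_amul.
have xr2 : nrm (ract x b) ^+ 2 <= r ^+ 2 * nrm b.
  have -> : nrm b = nrm x ^+ 2 by rewrite nrm_rip.
  rewrite -exprMn ler_pXn2r ?nnegrE ?mulr_ge0 ?nrm_ge0 //.
rewrite (nrm_rip x) -/b leNgt; apply/negP => rb.
have b_gt0 : 0 < nrm b by apply: le_lt_trans rb.
have : (nrm b ^+ 2) ^+ 2 <= r ^+ 2 * nrm b ^+ 2.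
  by apply: le_trans b4 _; rewrite mulrC [nrm b ^+ 2]expr2 mulrA ler_pM2r.
rewrite expr2 ler_pM2r ?exprn_gt0 // ler_pXn2r ?nnegrE ?(ltW b_gt0) //.
by rewrite leNgt rb.
Qed.

Lemma adjointable0 (U : adjointable X) : U 0 = 0.
Proof. by rewrite -(scale0r (0 : X)) adjointableZ !scale0r. Qed.

Lemma adjointableN (U : adjointable X) x : U (- x) = - U x.
Proof. by rewrite -scaleN1r adjointableZ scaleN1r. Qed.

Lemma adjointable_ract (U : adjointable X) x b : U (ract x b) = ract (U x) b.
Proof. by apply: rip_inj => z; rewrite ripM -!adjP_sym ripM. Qed.

End HilbertModuleNorm.

Section BoundedMaps.
Context (R : realType) (B : cstarAlgType R) (X : hilbertModType B).
Implicit Types (P Q : X -> X) (x y z : X) (t : R).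

Definition bounded_by (U : X -> X) t := forall z, nrm (U z) <= t * nrm z.

(* The maps [P + i Q] and [P - i Q] are [t] times isometries.                 *)
Lemma selfadjoint_bounded P Q t :
  0 <= t -> adjoint_of P P -> adjoint_of Q Q -> (forall z, P (Q z) = Q (P z)) ->
  (forall z, P (P z) + Q (Q z) = (t ^+ 2)%:C *: z) -> bounded_by P t.
Proof.
move=> t0 PP QQ PQ PQt z.
have isom (k : R[i]) : k^* = - k -> k * k = -1 -> nrm (P z + k *: Q z) <= t * nrm z.
  move=> kc k2; apply: nrm_le_of_rip; first by rewrite mulr_ge0 ?nrm_ge0.
  rewrite exprMn [nrm z ^+ 2]nrm_rip -[t ^+ 2]ger0_norm ?sqr_ge0 // -nrmZr.
  rewrite -ripZr -PQt !(ripDl, ripDr, ripZl, ripZr) kc !PP !QQ PQ.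
  rewrite le_eqVlt; apply/orP; left; apply/eqP; congr nrm.
  by lin_coefs R[i]; ring: k2.
have i2 : 'i * 'i = -1 :> R[i] by rewrite -expr2 sqrCi.
have := isom 'i (conjCi _) i2.
have := isom (- 'i); rewrite rmorphN /= conjCi mulrNN => /(_ erefl i2).
have := nrmD (P z + - 'i *: Q z) (P z + 'i *: Q z).
have -> : P z + - 'i *: Q z + (P z + 'i *: Q z) = 2%:C *: P z by lin_comb R[i].
by rewrite nrmZr ger0_norm //; lra.
Qed.

(** |U^* z|^2 = |<z, U U^* z>|; the 4 is the factor in [nrm_rip_le]. *)
Lemma bounded_adj (U : adjointable X) t :
  0 <= t -> bounded_by U t -> bounded_by (adj U) (4 * t).
Proof.
move=> t0 Ut z; have [-> | /eqP z0] := eqVneq (adj U z) 0.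
  by rewrite nrm0 !mulr_ge0 ?nrm_ge0.
have z_gt0 : 0 < nrm (adj U z) by rewrite lt0r nrm_ge0 andbT; apply/eqP => /nrm_eq0.
rewrite -(ler_pM2r z_gt0) -expr2 nrm_rip adjP_sym.
have := nrm_rip_le z (U (adj U z)); have := Ut (adj U z); have := nrm_ge0 z; nra.
Qed.

End BoundedMaps.

(** * A as a Hilbert module over itself *)

(** Through the left regular representation [lmul], whatever is proved for the images of elements of
    A under a *-homomorphism also yields norm bounds in A. *)
Definition self_module (R : realType) (A : cstarAlgType R) : Type := A.

Section SelfModule.
Context (R : realType) (A : cstarAlgType R).
Implicit Types (a b x y : A).

HB.instance Definition _ := CompleteNormedModule.copy (self_module A) A.

Definition self_rip (x y : self_module A) : A := amul (star (x : A)) y.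
Definition self_ract (x : self_module A) (b : A) : self_module A := amul (x : A) b.

Fact self_ractA x b c : self_ract x (amul b c) = self_ract (self_ract x b) c.
Proof. exact: amulA. Qed.
Fact self_ripDr x y z : self_rip x (y + z) = self_rip x y + self_rip x z.
Proof. exact: amulDr. Qed.
Fact self_ripZr (k : R[i]) x y : self_rip x (k *: y) = k *: self_rip x y.
Proof. exact: amulZr. Qed.
Fact self_ripM x y b : self_rip x (self_ract y b) = amul (self_rip x y) b.
Proof. exact: amulA. Qed.
Fact self_rip_star x y : star (self_rip x y) = self_rip y x.
Proof. by rewrite /self_rip starM starK. Qed.
Fact self_rip_nonneg x : star_nonneg (self_rip x x).
Proof. by exists x. Qed.

HB.instance Definition _ := isRightHilbertModule.Build R A (self_module A)
  self_ractA (@amulDl R A) (@amulDr R A) (@amulZl R A) (fun k x b => amulZr k x b)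
  self_ripDr self_ripZr self_ripM self_rip_star self_rip_nonneg
  (fun x => esym (normr_star_amul x)).

Lemma lmul_adjoint a :
  adjoint_of (fun x : self_module A => amul a x : self_module A) (amul (star a)).
Proof. by move=> x y; rewrite /rip /= /self_rip starM amulA. Qed.

Definition lmul a : adjointable (self_module A) := mkAdjointable (lmul_adjoint a).

Fact lmul_linear : linear lmul.
Proof. by move=> k a b; apply: adjointable_eq => x; rewrite /= amulDl amulZl. Qed.
Fact lmulM a b : lmul (amul a b) = amul (lmul a) (lmul b).
Proof. by apply: adjointable_eq => x; rewrite /= amulA. Qed.
Fact lmul_star a : lmul (star a) = star (lmul a).
Proof. by apply/esym/adj_uniq; exact: lmul_adjoint. Qed.

HB.instance Definition _ :=
  @GRing.isLinear.Build R[i] A (adjointable (self_module A)) *:%R lmul lmul_linear.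
HB.instance Definition _ :=
  isStarMultiplicative.Build R A (adjointable (self_module A)) lmul lmulM lmul_star.

End SelfModule.

(** * Square roots by a majorized iteration, and fixed points of contractions *)

Section SqrtMajorant.
Context (R : realType).

(** The iteration D -> (H + D^2) / 2 in the extreme scalar case H = 1. It increases to 1, the double
    root of 2 l = 1 + l^2. *)
Fixpoint sqrt_majorant (n : nat) : R :=
  if n is m.+1 then 2^-1 * (1 + sqrt_majorant m ^+ 2) else 0.
Local Notation s := sqrt_majorant.

Lemma sqrt_majorant_itv n : 0 <= s n <= 1.
Proof. by elim: n => [|n /andP[s0 s1]] /=; rewrite ?lexx ?ler01 //; nra. Qed.

Lemma sqrt_majorant_le n : s n <= s n.+1.
Proof. by rewrite /=; have := sqr_ge0 (s n - 1); lra. Qed.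

Lemma cvg_sqrt_majorant : s @ \oo --> (1 : R).
Proof.
have /cvg_ex[l sl] : cvgn s.
  apply: nondecreasing_is_cvgn.
    by apply/nondecreasing_seqP => n; exact: sqrt_majorant_le.
  by exists 1 => _ [n _ <-]; have /andP[] := sqrt_majorant_itv n.
have sl1 : (fun n => s n.+1) @ \oo --> l by have := sl; rewrite -cvg_shiftS.
have : (fun n => s n.+1) @ \oo --> 2^-1 * (1 + l ^+ 2).
  by apply: cvgMr; apply: cvgD; [exact: cvg_cst|exact: cvgM].
move=> /(cvg_unique (@Rhausdorff R) sl1) lE.
suff <- : l = 1 by [].
by have : (l - 1) ^+ 2 = 0; [lra|move/eqP; rewrite sqrf_eq0 subr_eq0 => /eqP].
Qed.

Lemma cvg_real_complex (u : nat -> R) (l : R) :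
  u @ \oo --> l ->
  (fun n => (u n)%:C : (R[i] : numFieldType)) @ \oo --> (l%:C : (R[i] : numFieldType)).
Proof.
move=> /cvgrPdistC_lt ul; apply/cvgrPdistC_lt => e e0.
have eE : e = (complex.Re e)%:C by rewrite RRe_real // gtr0_real.
have [|n0 n0_ n0P] := ul (complex.Re e); first by rewrite -(ltcR 0) -eE.
exists n0 => // n /= /n0P; rewrite eE -rmorphB normc_def /= expr0n addr0 sqrtr_sqr.
by rewrite ltcR.
Qed.

End SqrtMajorant.

Lemma cvgZ_real (R : realType) (V : normedModType R[i]) (s : nat -> R)
    (u : nat -> V) (k : R) (a : V) :
  s @ \oo --> k -> u @ \oo --> a -> (fun n => (s n)%:C *: u n) @ \oo --> k%:C *: a.
Proof. by move=> /cvg_real_complex sk ua; exact: cvgZ. Qed.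

(* In the unitization, D = eta + u solves 2 D = H + D^2 with H = eta + y, so    *)
(* that 1 - D is a square root of 1 - H. The scalar eta is 0 or 1.             *)
Section FormalSquareRoot.
Context (R : realType) (A : cstarAlgType R) (eta : R) (y : A).
Hypothesis etaK : eta * eta = eta.
Hypothesis y_small : forall z, nrm (eta%:C *: z + amul y z) <= nrm z.
Local Notation s := (@sqrt_majorant R).

(** The component in A of D_(n+1) = (H + D_n^2) / 2 with D_0 = 0. As eta^2 = eta, the scalar
    component is eta s_n, and [d n] below is left multiplication by D_n. *)
Fixpoint sqrt_seq (n : nat) : A :=
  if n is m.+1 then
    2^-1%:C *: (y + (2 * eta * s m)%:C *: sqrt_seq m + amul (sqrt_seq m) (sqrt_seq m))
  else 0.
Local Notation u := sqrt_seq.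
Let d n z := (eta * s n)%:C *: z + amul (u n) z.

Let dS n z : d n.+1 z = 2^-1%:C *: (eta%:C *: z + amul y z + d n (d n z)).
Proof.
rewrite /d /= !(amulDl, amulDr, amulZl, amulZr) !amulA.
have etaC : eta%:C * eta%:C = eta%:C by rewrite -rmorphM etaK.
lin_coefs R[i]; try by field.
rewrite !(rmorphM, rmorphD, rmorphXn, rmorph1) /=.
by ring: etaC.
Qed.

Let dB n x z : d n (x - z) = d n x - d n z.
Proof. by rewrite /d amulDr amulNr; lin_comb R[i]. Qed.

Let d_le n z : nrm (d n z) <= s n * nrm z.
Proof.
have /andP[s0 s1] := sqrt_majorant_itv R n.
elim: n z s0 s1 => [|n IH] z s0 s1.
  by rewrite /d /= mulr0 amul0l scale0r addr0 nrm0 mul0r.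
have /andP[sn0 sn1] := sqrt_majorant_itv R n.
rewrite dS nrmZr ger0_norm ?invr_ge0 //=.
have := nrmD (eta%:C *: z + amul y z) (d n (d n z)).
by have := (y_small z); have := IH (d n z) sn0 sn1; have := IH z sn0 sn1; nra.
Qed.

(** The splitting D'^2 - D^2 = D' (D' - D) + (D' - D) D holds without commutativity and has the same
    form for [s], so the majoration propagates. *)
Let d_incr n z : nrm (d n.+1 z - d n z) <= (s n.+1 - s n) * nrm z.
Proof.
elim: n z => [|n IH] z.
  have -> : d 0 z = 0 by rewrite /d /= mulr0 amul0l scale0r addr0.
  by rewrite !subr0; exact: d_le.
have -> : d n.+2 z - d n.+1 z = 2^-1%:C *:
    (d n.+1 (d n.+1 z - d n z) + (d n.+1 (d n z) - d n (d n z))).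
  by rewrite dB [d n.+2 z]dS [in X in _ - X]dS; lin_comb R[i].
rewrite nrmZr ger0_norm ?invr_ge0 //.
have /andP[sn0 sn1] := sqrt_majorant_itv R n.
have sn := sqrt_majorant_le R n; have /andP[sm0 sm1] := sqrt_majorant_itv R n.+1.
have := nrmD (d n.+1 (d n.+1 z - d n z)) (d n.+1 (d n z) - d n (d n z)).
have := d_le n.+1 (d n.+1 z - d n z).
have := IH z; have := IH (d n z); have := d_le n z.
have -> : s n.+2 - s n.+1 = 2^-1 * (s n.+1 + s n) * (s n.+1 - s n).
  transitivity (2^-1 * (1 + s n.+1 ^+ 2) - 2^-1 * (1 + s n ^+ 2)); first by [].
  by field.
have := nrm_ge0 z; move: (s n.+1) sn sm0 sm1 => sm sn sm0 sm1.
set N := nrm z; set N1 := nrm (d n z); set N2 := nrm (_ - d n z).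
set N3 := nrm (d _ (_ - _)); set N4 := nrm (_ - _) => N0 h1 h2 h3 h4 h5.
have := ler_wpM2l sm0 h3.
have : (sm - s n) * N1 <= (sm - s n) * (s n * N) by apply: ler_wpM2l => //; lra.
by lra.
Qed.

(** Removing the scalar component costs a second increment of [s], as 0 <= eta <= 1. *)
Let u_incr n : nrm (u n.+1 - u n) <= (2 * s n.+1) - 2 * s n.
Proof.
have sn := sqrt_majorant_le R n.
apply: nrm_le_of_mul => [|z]; first by lra.
have -> : amul (u n.+1 - u n) z =
    (d n.+1 z - d n z) - (eta * (s n.+1 - s n))%:C *: z.
  by rewrite /d amulDl amulNl; lin_comb R[i].
have := nrmB (d n.+1 z - d n z) ((eta * (s n.+1 - s n))%:C *: z).
rewrite nrmZr; have := d_incr n z.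
have eta01 : 0 <= eta <= 1.
  have /eqP : eta * (eta - 1) = 0 by rewrite mulrBr etaK mulr1 subrr.
  by rewrite mulf_eq0 subr_eq0 => /orP[] /eqP ->; rewrite lexx ler01.
have /andP[eta0 eta1] := eta01.
rewrite ger0_norm; last by rewrite mulr_ge0 ?subr_ge0.
have : eta * (s n.+1 - s n) * nrm z <= 1 * (s n.+1 - s n) * nrm z.
  by rewrite !ler_wpM2r ?nrm_ge0 ?subr_ge0.
by lra.
Qed.

(** Each u_n is a real polynomial in y without constant term, so it inherits self-adjointness and
    commutation from y. These properties and |D_n| <= s_n <= 1 pass to the limit, and s_n -> 1 turns
    the recursion into the equation. *)
Lemma formal_sqrt : exists u : A,
  [/\ 2%:C *: u = y + (2 * eta)%:C *: u + amul u u,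
      forall z, nrm (eta%:C *: z + amul u z) <= nrm z,
      star y = y -> star u = u &
      forall c, amul y c = amul c y -> amul u c = amul c u].
Proof.
have /cvg_ex[/= l ul] : cvgn u.
  apply: (cvg_majorant u_incr (M := 2)) => n.
  by have /andP[] := sqrt_majorant_itv R n; lra.
have s1 := @cvg_sqrt_majorant R.
have ul1 : (fun n => u n.+1) @ \oo --> l by have := ul; rewrite -cvg_shiftS.
exists l; split.
- have lE : l = 2^-1%:C *: (y + (2 * eta)%:C *: l + amul l l).
    apply: (@cvg_unique A _ ((fun n => u n.+1) @ \oo)) => //.
    apply: cvgZl_tmp; apply: cvgD; last exact: cvg_amul.
    apply: cvgD; first exact: cvg_cst.
    apply: cvgZ_real => //; rewrite -[in X in _ --> X](mulr1 (2 * eta)).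
    exact: cvgMr.
  by rewrite {1}lE; lin_comb R[i].
- move=> z; apply: (cvg_nrm_le (u := d^~ z)).
    apply: cvgD; last by apply: cvg_amul => //; exact: cvg_cst.
    rewrite -[in X in _ --> X](mulr1 eta).
    apply: cvgZ_real; last exact: cvg_cst.
    by apply: cvgMr.
  move=> n; have /andP[s0 s_le1] := sqrt_majorant_itv R n.
  by have := d_le n z; have := nrm_ge0 z; nra.
- move=> yy.
  have uu n : star (u n) = u n.
    by elim: n => [|n IH] /=; rewrite ?star0 // starZr !(starD, starM, starZr, yy, IH).
  apply: (@cvg_unique A _ (u @ \oo)) => //.
  have := cvg_star ul; under eq_fun do rewrite uu; done.
- move=> c yc.
  have uc n : amul (u n) c = amul c (u n).
    elim: n => [|n IH] /=; first by rewrite amul0l amul0r.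
    by rewrite !(amulDl, amulDr, amulZl, amulZr) yc IH -amulA IH !amulA IH.
  apply: (@cvg_unique A _ ((fun n => amul (u n) c) @ \oo)).
  - exact: norm_hausdorff.
  - by apply: cvg_amul => //; exact: cvg_cst.
  - have -> : (fun n => amul (u n) c) = (fun n => amul c (u n)) by exact/funext.
    by apply: cvg_amul => //; exact: cvg_cst.
Qed.

End FormalSquareRoot.

Lemma contraction_fixpoint (R : realType) (V : completeNormedModType R[i])
    (F : V -> V) (q : R) :
  0 <= q -> q < 1 -> (forall x y, nrm (F x - F y) <= q * nrm (x - y)) ->
  exists x, F x = x.
Proof.
(* C is the sum of the geometric series that bounds the increments; its partial sums C (1 - q^n) are
   the majorant. *)
move=> q0 q1 Fq; pose u n := iter n F 0; pose C := nrm (u 1%N - u 0%N) / (1 - q).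
have u_incr n : nrm (u n.+1 - u n) <= C * (1 - q ^+ n.+1) - C * (1 - q ^+ n).
  have -> : C * (1 - q ^+ n.+1) - C * (1 - q ^+ n) = q ^+ n * (C * (1 - q)).
    by rewrite exprS; ring.
  rewrite divfK ?gt_eqF ?subr_gt0 //.
  elim: n => [|n IH]; first by rewrite mul1r.
  by apply: le_trans (Fq _ _) _; rewrite exprS -mulrA ler_wpM2l.
have /cvg_ex[/= l ul] : cvgn u.
  apply: (cvg_majorant u_incr (M := C)) => n.
  have : 0 <= q ^+ n by rewrite exprn_ge0.
  have : 0 <= C by rewrite divr_ge0 ?nrm_ge0 // subr_ge0 ltW.
  nra.
exists l; apply: (@cvg_unique V _ ((fun n => u n.+1) @ \oo)) => //.
  move/cvg_nrmP: ul => ul; apply/cvg_nrmP => e /ul[n0 n0P].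
  exists n0 => n /n0P; apply: le_lt_trans; apply: le_trans (Fq _ _) _.
  by rewrite ler_piMl ?nrm_ge0 // ltW.
by have := ul; rewrite -cvg_shiftS.
Qed.

(** * Homomorphisms into the adjointable maps *)

Section HomTheory.
Context (R : realType) (A B : cstarAlgType R) (X : hilbertModType B).
Context (phi : {starhom A -> adjointable X}).
Implicit Types (a b c : A) (z : X) (t : R).

Lemma homDE a b z : phi (a + b) z = phi a z + phi b z.
Proof. by rewrite raddfD. Qed.

Lemma homNE a z : phi (- a) z = - phi a z.
Proof. by rewrite raddfN. Qed.

Lemma homZE (k : R[i]) a z : phi (k *: a) z = k *: phi a z.
Proof. by rewrite linearZ. Qed.

Lemma homME a b z : phi (amul a b) z = phi a (phi b z).
Proof. by rewrite starhomM. Qed.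

Definition homE := (homDE, homNE, homZE, homME).

Lemma hom_star_adjoint a : adjoint_of (phi a) (phi (star a)).
Proof. by move=> x y; rewrite starhom_star; exact: adjP. Qed.

Lemma hom_adjoint a : star a = a -> adjoint_of (phi a) (phi a).
Proof. by move=> aa x y; rewrite hom_star_adjoint aa. Qed.

Lemma hom_square_eq0 a : star a = a -> phi (amul a a) = 0 -> phi a = 0.
Proof.
move=> aa a2; apply: adjointable_eq => z; apply: rip_eq0.
by rewrite hom_adjoint // -homME a2 rip0r.
Qed.

End HomTheory.

(** * Self-adjoint elements: bounds on their images, and resolvents *)

Section SelfAdjoint.
Context (R : realType) (A : cstarAlgType R).
Implicit Types (a b c e : A) (t : R).

(* [t - d] is the square root of [t^2 - a^2].                                  *)
Lemma sqrt_complement a t : star a = a -> 0 < t -> nrm a <= t ->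
  exists d, [/\ star d = d, amul a d = amul d a &
    (2 * t)%:C *: d = amul a a + amul d d].
Proof.
move=> aa t0 at_; pose y := (t ^- 2)%:C *: amul a a.
have y_small z : nrm ((0 : R)%:C *: z + amul y z) <= nrm z.
  rewrite scale0r add0r; apply: le_trans (nrm_amul _ _) _.
  rewrite ler_piMl ?nrm_ge0 // /y nrmZr ger0_norm ?invr_ge0 ?sqr_ge0 //.
  rewrite mulrC ler_pdivrMr ?exprn_gt0 // mul1r -{1}aa nrm_star_amul.
  by rewrite ler_pXn2r ?nnegrE ?nrm_ge0 ?(ltW t0).
(* With eta = 0 and H = a^2 / t^2; rescaling the solution by t gives d. *)
have [u [uE _ us uc]] := formal_sqrt (mul0r 0) y_small.
exists (t%:C *: u); split.
- by rewrite starZr us // /y starZr starM aa.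
- rewrite amulZr amulZl uc // /y amulZl amulZr amulA //.
- rewrite scalerA [_ * t%:C]mulrC -rmorphM.
  have -> : (t * (2 * t))%:C *: u = (t * t)%:C *: (2%:C *: u) by lin_comb R[i].
  rewrite uE /y amulZl amulZr mulr0 scale0r addr0.
  have t2 : (t * t)%:C * (t ^- 2)%:C = 1 :> R[i].
    by rewrite -rmorphM /= -expr2 divff // expf_neq0 // gt_eqF.
  by rewrite scalerDr !scalerA t2 scale1r -rmorphM.
Qed.

Section HomBound.
Context (B : cstarAlgType R) (X : hilbertModType B).
Context (phi : {starhom A -> adjointable X}).

(** With d from [sqrt_complement], phi a and Q = t - phi d commute and phi(a)^2 + Q^2 = t^2, so both
    are bounded by t. The second bound is that of Q^2. *)
Lemma hom_selfadjoint_bounded a t : star a = a -> 0 < t -> nrm a <= t ->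
  bounded_by (phi a) t /\
  bounded_by (fun z => (t ^+ 2)%:C *: z - phi a (phi a z)) (t ^+ 2).
Proof.
move=> aa t0 at_; have [d [dd ad dE]] := sqrt_complement aa t0 at_.
pose Q z := t%:C *: z - phi d z.
have QQ : adjoint_of Q Q.
  move=> x z; rewrite /Q !(ripDl, ripDr, ripNl, ripNr, ripZl, ripZr) conjCr.
  by rewrite hom_adjoint.
have PQ z : phi a (Q z) = Q (phi a z).
  by rewrite /Q adjointableD adjointableN adjointableZ -!homME ad.
have QQE z : Q (Q z) = (t ^+ 2)%:C *: z - phi a (phi a z).
  rewrite /Q adjointableD adjointableN adjointableZ -!homME.
  have -> : amul a a = (2 * t)%:C *: d - amul d d by rewrite dE addrK.
  by rewrite !homE; lin_comb R[i].
have P_le : bounded_by (phi a) t.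
  apply: (selfadjoint_bounded (ltW t0) (hom_adjoint phi aa) QQ PQ) => z.
  by rewrite QQE addrC subrK.
have Q_le : bounded_by Q t.
  apply: (selfadjoint_bounded (ltW t0) QQ (hom_adjoint phi aa)) => // z.
  by rewrite QQE subrK.
split=> // z; rewrite -QQE; have := Q_le (Q z); have := Q_le z.
have := nrm_ge0 z; nra.
Qed.

(** Constant 1 for self-adjoint elements; the real and imaginary parts of [a] have norm at most |a|
    and contribute once each. *)
Lemma hom_bounded a : bounded_by (phi a) (2 * nrm a).
Proof.
have sa b : star b = b -> bounded_by (phi b) (nrm b).
  move=> bb z; apply/ler_addgt0Pr => e e0.
  pose d := e / (nrm z + 1).
  have z1 : 0 < nrm z + 1 by have := nrm_ge0 z; lra.
  have d0 : 0 < d by rewrite divr_gt0.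
  have [||/(_ z) + _] := hom_selfadjoint_bounded (t := nrm b + d) bb.
  - by have := nrm_ge0 b; lra.
  - by lra.
  have dz : d * (nrm z + 1) = e by rewrite divfK // gt_eqF.
  by lra.
have half (x y : A) : nrm x <= nrm a -> nrm y <= nrm a ->
    nrm (2^-1%:C *: (x + y)) <= nrm a.
  move=> xa ya; rewrite nrmZr ger0_norm ?invr_ge0 //.
  by have := nrmD x y; lra.
move=> z.
have -> : phi a z = phi (re_part a) z + 'i *: phi (im_part a) z.
  by rewrite -homZE -homDE -re_im_partE.
have := nrmD (phi (re_part a) z) ('i *: phi (im_part a) z); rewrite nrmZi.
have := sa _ (re_partS a) z; have := sa _ (im_partS a) z.
have : nrm (re_part a) <= nrm a by apply: half; rewrite ?nrm_star.
have : nrm (im_part a) <= nrm a.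
  by rewrite /im_part scalerA mulrC -scalerA nrmZi; apply: half; rewrite ?nrmN ?nrm_star.
move=> im_le re_le; have := ler_wpM2r (nrm_ge0 z) im_le.
by have := ler_wpM2r (nrm_ge0 z) re_le; lra.
Qed.

End HomBound.

(** The regular representation again. This inequality is the form in which the positivity of a^2 is
    used. *)
Lemma square_contraction a t : star a = a -> 0 < t -> nrm a <= t ->
  forall z, nrm ((t ^+ 2)%:C *: z - amul (amul a a) z) <= t ^+ 2 * nrm z.
Proof.
move=> aa t0 at_ z; have [_ /(_ z)] := hom_selfadjoint_bounded (lmul (A := A)) aa t0 at_.
by rewrite /= amulA.
Qed.

(* [e] is a^2 / (1 + a^2).                                                      *)
Lemma resolvent a : star a = a -> exists e,
  [/\ star e = e, amul a e = amul e a & e + amul (amul a a) e = amul a a].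
Proof.
move=> aa; pose t := nrm a + 1.
have t0 : 0 < t by have := nrm_ge0 a; rewrite /t; lra.
have at_ : nrm a <= t by rewrite /t; lra.
have k0 : 0 < t ^+ 2 by rewrite exprn_gt0.
have k1 : 0 < 1 + t ^+ 2 by lra.
set y := amul a a; have yE : y = amul a a by [].
pose q := t ^+ 2 / (1 + t ^+ 2).
have F_le z : nrm ((1 + t ^+ 2)^-1%:C *: ((t ^+ 2)%:C *: z - amul y z)) <= q * nrm z.
  rewrite nrmZr ger0_norm ?invr_ge0 ?(ltW k1) // ler_pdivrMl //.
  have -> : (1 + t ^+ 2) * (q * nrm z) = t ^+ 2 * nrm z.
    by rewrite /q mulrA mulrCA divff ?gt_eqF // mulr1.
  exact: square_contraction.
have q1 : q < 1 by rewrite ltr_pdivrMr //; lra.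
have q0 : 0 <= q by rewrite divr_ge0 // ltW.
have kC : (1 + t ^+ 2)%:C * (1 + t ^+ 2)^-1%:C = 1 :> R[i].
  by rewrite -rmorphM /= divff // gt_eqF.
(* (1 + y) e = y is the fixed-point equation of z -> (y + t^2 z - y z) / (1 + t^2), a contraction
   because |t^2 - y| <= t^2. *)
have [|e eE] := @contraction_fixpoint R A (fun z =>
  (1 + t ^+ 2)^-1%:C *: (y + ((t ^+ 2)%:C *: z - amul y z))) q q0 q1.
  move=> z w; apply: le_trans (F_le (z - w)).
  rewrite le_eqVlt; apply/orP; left; apply/eqP; congr nrm.
  by rewrite amulDr amulNr; lin_comb R[i].
(* A solution is fixed by the linear part of that contraction, hence zero. *)
have inj z : z + amul y z = 0 -> z = 0.
  move=> z0; apply: nrm_eq0; apply/le_anti; rewrite nrm_ge0 andbT.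
  have : nrm z <= q * nrm z.
    have {1}-> : z = (1 + t ^+ 2)^-1%:C *: ((t ^+ 2)%:C *: z - amul y z).
      have -> : amul y z = - z by apply/eqP; rewrite -addr_eq0 addrC z0.
      rewrite opprK.
      have -> : (t ^+ 2)%:C *: z + z = (1 + t ^+ 2)%:C *: z by lin_comb R[i].
      by rewrite scalerA mulrC kC scale1r.
    exact: F_le.
  by have := nrm_ge0 z; nra.
have {}eE : e + amul y e = y.
  have : (1 + t ^+ 2)%:C *: e = y + ((t ^+ 2)%:C *: e - amul y e).
    by rewrite -{1}eE scalerA kC scale1r.
  have -> : (1 + t ^+ 2)%:C *: e = e + (t ^+ 2)%:C *: e by lin_comb R[i].
  move/(congr1 (fun v => v + (amul y e - (t ^+ 2)%:C *: e))).
  by rewrite addrACA => eE0; apply: etrans (etrans eE0 _); lin_comb R[i].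
have yy : star y = y by rewrite yE starM aa.
have ya c : amul a (amul y c) = amul y (amul a c) by rewrite yE !amulA.
exists e; split=> //.
  have se : star e + amul (star e) y = y.
    by rewrite -{1}yy -starM -starD eE yy.
  (* (1 - e^* ) and (1 - e) are a left and a right inverse of 1 + y. *)
  have ye : amul y e = amul (star e) y.
    have h1 : amul (star e) e + amul (amul (star e) y) e = amul (star e) y.
      by rewrite -amulA -amulDr eE.
    have h2 : amul (star e) e + amul (amul (star e) y) e = amul y e.
      by rewrite -amulDl se.
    by rewrite -h2 h1.
  by apply: (addIr (amul y e)); rewrite eE ye.
(* Both a e and e a solve (1 + y) z = a y = y a. *)
apply: subr0_eq; apply: inj.
have h1 : amul a e + amul y (amul a e) = amul a y by rewrite -ya -amulDr eE.
have h2 : amul e a + amul y (amul e a) = amul y a.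
  by rewrite amulA -amulDl eE.
rewrite amulDr amulNr addrACA h1 -opprD h2.
by rewrite yE amulA subrr.
Qed.

End SelfAdjoint.

(** * Truncation, lifting with norm control, and closedness of the range *)

Section RealNormCvg.
Context (R : realType) (V : normedModType R[i]).
Implicit Types (u : nat -> V) (w : nat -> R) (l : V).

Lemma cvg_nrm0 u l : u @ \oo --> l -> (fun n => nrm (u n - l)) @ \oo --> (0 : R).
Proof.
move=> /cvg_nrmP ul; apply/cvgrPdistC_lt => e /ul[n0 n0P].
by exists n0 => // n /= /n0P; rewrite subr0 ger0_norm ?nrm_ge0.
Qed.

Lemma cvg_nrm_bound u w l :
  (forall n, nrm (u n - l) <= w n) -> w @ \oo --> (0 : R) -> u @ \oo --> l.
Proof.
move=> uw /cvgrPdistC_lt w0; apply/cvg_nrmP => e /w0[n0 _ n0P].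
exists n0 => n /n0P /=; rewrite subr0; apply: le_lt_trans.
by apply: le_trans (uw n) _; exact: ler_norm.
Qed.

Lemma nrm_half (x y : V) (r s : R) : nrm x <= r -> nrm y <= s ->
  nrm (2^-1%:C *: (x + y)) <= 2^-1 * (r + s).
Proof.
by move=> xr ys; rewrite nrmZr ger0_norm ?invr_ge0 //; have := nrmD x y; lra.
Qed.

End RealNormCvg.

(* [b] is a / (1 + a^2), which is close to [a] where [a] is small and bounded  *)
(* everywhere; (b, e - 1/2) lies on a circle of radius 1/2.                    *)
Lemma truncation (R : realType) (A : cstarAlgType R) (a : A) : star a = a ->
  exists b e, [/\ star b = b, star e = e, amul b e = amul e b,
    amul b b = e - amul e e & amul (amul a a) b = a - b].
Proof.
move=> aa; have [e [ee ae eE]] := resolvent aa.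
have ye : amul (amul a a) e = amul a a - e by apply/esym/eqP; rewrite subr_eq addrC eE.
exists (a - amul a e), e; split => //.
- by rewrite starD starN starM aa ee ae.
- by rewrite amulDl amulDr amulNl amulNr !amulA -ae.
- rewrite !(amulDl, amulDr, amulNl, amulNr).
  have -> : amul (amul a e) (amul a e) = amul a a - e - amul e e.
    by rewrite -amulA [amul e (amul a e)]amulA -ae !amulA ye amulDl amulNl ye.
  have -> : amul (amul a e) a = amul a a - e by rewrite -amulA -ae amulA ye.
  by rewrite amulA ye; lin_comb R[i].
- rewrite subKr amulDr amulNr.
  have -> : amul (amul a a) (amul a e) = amul a (amul (amul a a) e).
    by rewrite !amulA.
  by rewrite ye amulDr amulNr !amulA; lin_comb R[i].
Qed.

(** b^2 = e - e^2 means b^2 + (1/2 - e)^2 = 1/4, so [selfadjoint_bounded] applies. Used with [lmul]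
    for the norm of b in A, and with phi for its image. *)
Lemma truncation_bounded (R : realType) (A B : cstarAlgType R) (X : hilbertModType B)
    (phi : {starhom A -> adjointable X}) (b e : A) :
  star b = b -> star e = e -> amul b e = amul e b ->
  
  amul b b = e - amul e e -> bounded_by (phi b) 2^-1.
Proof.
move=> bb ee be bE; pose Q z := 2^-1%:C *: z - phi e z.
have QQ : adjoint_of Q Q.
  move=> x z; rewrite /Q !(ripDl, ripDr, ripNl, ripNr, ripZl, ripZr) conjCr.
  by rewrite hom_adjoint.
apply: (selfadjoint_bounded _ (hom_adjoint phi bb) QQ) => [|z|z].
- by rewrite invr_ge0.
- by rewrite /Q adjointableD adjointableN adjointableZ -!homME be.
rewrite /Q -homME bE adjointableD adjointableN adjointableZ homDE homNE homME.
by lin_comb R[i].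
Qed.

Section Range.
Context (R : realType) (A B : cstarAlgType R) (X : hilbertModType B).
Context (phi : {starhom A -> adjointable X}).
Implicit Types (a b c : A) (z : X) (t r : R) (U V W : adjointable X).

Lemma boundedD U V t r :
  bounded_by U t -> bounded_by V r -> bounded_by (U + V) (t + r).
Proof.
move=> Ut Vr z; rewrite adjointable_addE; have := nrmD (U z) (V z).
by have := Ut z; have := Vr z; lra.
Qed.

Lemma bounded_le U t r : t <= r -> bounded_by U t -> bounded_by U r.
Proof. by move=> tr Ut z; apply: le_trans (Ut z) _; rewrite ler_wpM2r ?nrm_ge0. Qed.

(** However large |a| is, the truncation b' of a' = a / r has norm at most 1/2. The error a' - b' =
    a'^2 b' also has image bounded by 1/2, since phi a' is a contraction. *)
Lemma approximate_lift a r : star a = a -> 0 < r -> bounded_by (phi a) r ->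
  exists b, [/\ star b = b, nrm b <= 2^-1 * r & bounded_by (phi (a - b)) (2^-1 * r)].
Proof.
move=> aa r0 ar; pose a' := r^-1%:C *: a.
have aE : a = r%:C *: a'.
  by rewrite /a' scalerA -rmorphM /= divff ?gt_eqF // scale1r.
have aa' : star a' = a' by rewrite /a' starZr aa.
have [b [e [bb ee be bE a'b]]] := truncation aa'.
have b_le := truncation_bounded phi bb ee be bE.
exists (r%:C *: b); split.
- by rewrite starZr bb.
- rewrite nrmZr ger0_norm ?(ltW r0) // mulrC ler_wpM2r ?(ltW r0) //.
  apply: nrm_le_of_mul; first by rewrite invr_ge0.
  exact: (truncation_bounded (lmul (A := A)) bb ee be bE).
move=> z; have -> : a - r%:C *: b = r%:C *: amul (amul a' a') b.
  by rewrite a'b {1}aE scalerBr.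
have a'_le w : nrm (phi a' w) <= nrm w.
  rewrite /a' homZE nrmZr ger0_norm ?invr_ge0 ?(ltW r0) //.
  by rewrite ler_pdivrMl //; exact: ar.
have small : nrm (phi (amul (amul a' a') b) z) <= 2^-1 * nrm z.
  by rewrite !homME; do 2 (apply: le_trans (a'_le _) _); exact: b_le.
rewrite homZE nrmZr ger0_norm ?(ltW r0) //.
by have := ler_wpM2l (ltW r0) small; lra.
Qed.

(** The fifth absorbs the factor 4 that [bounded_adj] loses on the adjoint. *)
Lemma re_part_approx U a e : 0 <= e -> bounded_by (U - phi a) (5^-1 * e) ->
  bounded_by (re_part U - phi (re_part a)) e.
Proof.
move=> e0 aP z.
have adjE : adj (U - phi a) = adj U - phi (star a).
  apply: adj_uniq => x y.
  have -> : (adj U - phi (star a)) y = adj U y - phi (star a) y by [].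
  have -> : (U - phi a) x = U x - phi a x by [].
  by rewrite ripDl ripNl ripBr adjP hom_star_adjoint.
have reE : (re_part U - phi (re_part a)) z =
    2^-1%:C *: ((U - phi a) z + adj (U - phi a) z).
  rewrite adjE.
  have -> : (re_part U - phi (re_part a)) z =
      2^-1%:C *: (U z + adj U z) - 2^-1%:C *: (phi a z + phi (star a) z).
    by rewrite -homDE -homZE.
  have -> : (adj U - phi (star a)) z = adj U z - phi (star a) z by [].
  have -> : (U - phi a) z = U z - phi a z by [].
  by lin_comb R[i].
have e5 : 0 <= 5^-1 * e by lra.
rewrite reE; apply: le_trans (nrm_half (aP z) (bounded_adj e5 aP z)) _.
have : 0 <= e * nrm z by rewrite mulr_ge0 ?nrm_ge0.
by lra.
Qed.

(** Subtracting approximate lifts from V leaves remainders bounded by r (3/4)^n; the lifts are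
    dominated by the same series, whose sum is 4 r. *)
Lemma selfadjoint_range V r : adjoint_of V V -> 0 < r -> bounded_by V r ->
  (forall e, 0 < e -> exists a, bounded_by (V - phi a) e) ->
  exists2 b, phi b = V & nrm b <= 4 * r.
Proof.
move=> VV r0 Vr Vapprox.
pose approx W := forall e, 0 < e -> exists a, bounded_by (W - phi a) e.
have approx_sa W : adjoint_of W W -> approx W -> forall e, 0 < e ->
    exists2 a, star a = a & bounded_by (W - phi a) e.
  move=> WW Wapprox e e0; have [|a aP] := Wapprox (5^-1 * e); first by lra.
  exists (re_part a) => [|z]; first exact: re_partS.
  have WE : (W - phi (re_part a)) z = (re_part W - phi (re_part a)) z.
    have adjW : adj W = W by exact: adj_uniq.
    have -> : (re_part W - phi (re_part a)) z =
      2^-1%:C *: (W z + adj W z) - phi (re_part a) z by [].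
    have -> : (W - phi (re_part a)) z = W z - phi (re_part a) z by [].
    by rewrite adjW; lin_comb R[i].
  by have := re_part_approx (ltW e0) aP z; rewrite -WE.
(* The hypotheses come after the existential so that [choice] yields a total function; when they
   fail, b = 0 is a dummy value. *)
have step (p : adjointable X * R) : exists b, 0 < p.2 -> adjoint_of p.1 p.1 ->
    approx p.1 -> bounded_by p.1 p.2 ->
    [/\ star b = b, nrm b <= p.2 & bounded_by (p.1 - phi b) (3 / 4 * p.2)].
  case: p => W t /=; have [[t0 WW Wapprox Wt]|no] :=
    pselect [/\ 0 < t, adjoint_of W W, approx W & bounded_by W t]; last first.
    by exists 0 => *; case: no.
  (* An eighth suffices: |phi a| <= 9/8 t, so |b| <= 9/16 t <= t and the error is at most (1/8 +
     9/16) t <= 3/4 t. *)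
  have [|a aa aP] := approx_sa W WW Wapprox (8^-1 * t); first by lra.
  have at_ : bounded_by (phi a) (9 / 8 * t).
    move=> z; have := nrmD (W z) (- (W - phi a) z).
    have -> : W z + (- (W - phi a)) z = phi a z by rewrite opprB addrC subrK.
    have -> : nrm ((- (W - phi a)) z) = nrm ((W - phi a) z) by exact: nrmN.
    by have := Wt z; have := aP z; lra.
  have [|b [bb b_le abP]] := approximate_lift aa _ at_; first by lra.
  exists b => _ _ _ _; split=> //; first by lra.
  move=> z; have sub : nrm ((W - phi b) z) <= nrm ((W - phi a) z) + nrm (phi (a - b) z).
    have -> : (W - phi b) z = (W - phi a) z + phi (a - b) z.
      rewrite homDE homNE.
      have -> : (W - phi b) z = W z - phi b z by [].
      have -> : (W - phi a) z = W z - phi a z by [].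
      by lin_comb R[i].
    exact: nrmD.
  apply: le_trans sub _; apply: le_trans (lerD (aP z) (abP z)) _.
  have : 0 <= t * nrm z by rewrite mulr_ge0 ?nrm_ge0 ?(ltW t0).
  by lra.
have [g gP] := choice step.
pose q : R := 3 / 4.
pose W := nat_rect (fun=> adjointable X) V (fun n W => W - phi (g (W, r * q ^+ n))).
pose b n := g (W n, r * q ^+ n).
have rq n : 0 < r * q ^+ n by rewrite mulr_gt0 // exprn_gt0 // /q; lra.
have WP n : [/\ adjoint_of (W n) (W n), approx (W n) & bounded_by (W n) (r * q ^+ n)].
  elim: n => [|n [WW Wa Wb]]; first by split=> //; rewrite mulr1.
  have [bb b_le bP] := gP (W n, r * q ^+ n) (rq n) WW Wa Wb.
  split=> /=.
  - move=> x y; rewrite ripDl ripDr ripNl ripNr WW hom_adjoint //.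
  - move=> e /Wa[a aP]; exists (a - b n).
    by rewrite raddfB /= opprB addrA subrK.
  - by rewrite exprS mulrCA.
have b_le n : nrm (b n) <= r * q ^+ n.
  by have [WW Wa Wb] := WP n; have [] := gP (W n, r * q ^+ n) (rq n) WW Wa Wb.
pose beta n := \sum_(k < n) b k.
have betaS n : beta n.+1 - beta n = b n.
  by rewrite /beta big_ord_recr /= addrAC subrr add0r.
have WE n : W n = V - phi (beta n).
  elim: n => [|n IH]; first by rewrite /beta big_ord0 raddf0 subr0.
  by rewrite /= -/(b n) IH /beta big_ord_recr /= raddfD opprD addrA.
have beta_incr n : nrm (beta n.+1 - beta n) <=
    4 * r * (1 - q ^+ n.+1) - 4 * r * (1 - q ^+ n).
  by rewrite betaS exprS /q; have := b_le n; rewrite /q; lra.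
have qn n : 0 <= q ^+ n by rewrite exprn_ge0 // /q; lra.
have s_le n : 4 * r * (1 - q ^+ n) <= 4 * r by have := qn n; nra.
have /cvg_ex[/= l betal] := cvg_majorant beta_incr s_le.
exists l; last first.
  apply: (cvg_nrm_le betal) => n; apply: le_trans (s_le n).
  elim: n => [|n IH]; first by rewrite /beta big_ord0 nrm0 subrr mulr0.
  by have := nrmD (beta n.+1 - beta n) (beta n); rewrite subrK; have := beta_incr n; lra.
apply: adjointable_eq => z.
apply: (@cvg_unique X _ ((fun n => phi (beta n) z) @ \oo)) => //.
  apply: (cvg_nrm_bound (w := fun n => 2 * nrm (beta n - l) * nrm z)) => [n|].
    by rewrite -homNE -homDE; exact: hom_bounded.
  rewrite -(mul0r (nrm z)) -(mulr0 2).
  apply: cvgM; last exact: cvg_cst.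
  by apply: cvgM; [exact: cvg_cst | exact: cvg_nrm0].
apply: (cvg_nrm_bound (w := fun n => r * q ^+ n * nrm z)) => [n|].
  rewrite nrm_sub; have [_ _ /(_ z)] := WP n; by rewrite WE.
rewrite -(mul0r (nrm z)) -(mulr0 r).
apply: cvgM; last exact: cvg_cst.
apply: cvgM; first exact: cvg_cst.
by apply: cvg_expr; rewrite ger0_norm /q; lra.
Qed.

(** U = re U + i re(- i U), so the self-adjoint case, applied to U and to - i U, is enough. *)
Lemma range_closed U t : bounded_by U t ->
  (forall e, 0 < e -> exists a, bounded_by (U - phi a) e) -> range phi U.
Proof.
have re_range V r : bounded_by V r ->
    (forall e, 0 < e -> exists a, bounded_by (V - phi a) e) -> range phi (re_part V).
  move=> Vr Vapprox.
  pose r' := `|r| + 1; have r'0 : 0 < r' by have := normr_ge0 r; rewrite /r'; lra.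
  have Vr' : bounded_by V r'.
    by apply: bounded_le Vr; rewrite /r'; have := ler_norm r; lra.
  have reV z : re_part V z = 2^-1%:C *: (V z + adj V z) by [].
  have [|||e e0|b <- _] := @selfadjoint_range (re_part V) (4 * r').
  - move=> x y; rewrite !reV !(ripZl, ripZr, ripDl, ripDr) conjCr adjP adjP_sym.
    by rewrite [in LHS]addrC.
  - by lra.
  - move=> z; rewrite reV.
    apply: le_trans (nrm_half (Vr' z) (bounded_adj (ltW r'0) Vr' z)) _.
    have : 0 <= r' * nrm z by rewrite mulr_ge0 ?nrm_ge0 ?(ltW r'0).
    by lra.
  - have [|a aP] := Vapprox (5^-1 * e); first by lra.
    by exists (re_part a); exact: re_part_approx (ltW e0) aP.
  - by exists b.
move=> Ut Uapprox; have [b _ bE] := re_range U t Ut Uapprox.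
have [z|e e0|c _ cE] := re_range (- 'i *: U) t.
- by rewrite adjointable_scaleE scaleNr nrmN nrmZi; exact: Ut.
- have [a aP] := Uapprox e e0; exists (- 'i *: a) => z.
  have -> : (- 'i *: U - phi (- 'i *: a)) z = - ('i *: (U - phi a) z).
    have -> : (- 'i *: U - phi (- 'i *: a)) z = - 'i *: U z - phi (- 'i *: a) z by [].
    have -> : (U - phi a) z = U z - phi a z by [].
    by rewrite homZE; lin_comb R[i].
  by rewrite nrmN nrmZi; exact: aP.
exists (b + 'i *: c) => //; apply: adjointable_eq => z; rewrite homDE homZE bE cE.
have -> : re_part U z = 2^-1%:C *: (U z + adj U z) by [].
have -> : re_part (- 'i *: U) z = 2^-1%:C *: (- 'i *: U z + adj (- 'i *: U) z) by [].
have -> : adj (- 'i *: U) z = 'i *: adj U z.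
  by rewrite Defs.adjZ rmorphN /= conjCi opprK.
have i2 : 'i * 'i = -1 :> R[i] by rewrite -expr2 sqrCi.
have h2 : 2^-1%:C + 2^-1%:C = 1 :> R[i] by field.
by lin_coefs R[i]; ring: i2 h2.
Qed.

End Range.

(** * Square roots of positive elements and positivity of [theta x x] *)

Section Positivity.
Context (R : realType) (A : cstarAlgType R).
Implicit Types (a b c h p y z : A) (t : R).

Lemma star_amul_eq0 a : amul (star a) a = 0 -> a = 0.
Proof.
move=> a0; apply: nrm_eq0; apply/eqP; rewrite -sqrf_eq0 -nrm_star_amul a0.
by rewrite nrm0.
Qed.

(** [formal_sqrt] with eta = 1 and H = 1 - y / t^2: then - u = 1 - D is a root of y / t^2. The last
    conclusion has the form of the hypothesis, so that roots can be iterated. *)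
Lemma positive_sqrt y t : 0 < t -> star y = y ->
  (forall z, nrm ((t ^+ 2)%:C *: z - amul y z) <= t ^+ 2 * nrm z) ->
  exists c, [/\ star c = c, amul c c = y,
    forall b, amul y b = amul b y -> amul c b = amul b c &
    forall z, nrm (t%:C *: z - amul c z) <= t * nrm z].
Proof.
move=> t0 yy y_le; pose y' := - ((t ^- 2)%:C *: y).
have t2 : 0 < t ^+ 2 by rewrite exprn_gt0.
have t2C : (t ^+ 2)%:C * (t ^- 2)%:C = 1 :> R[i].
  by rewrite -rmorphM /= divff // gt_eqF.
have y'_le z : nrm ((1 : R)%:C *: z + amul y' z) <= nrm z.
  have -> : 1%:C *: z + amul y' z = (t ^- 2)%:C *: ((t ^+ 2)%:C *: z - amul y z).
    rewrite /y' amulNl amulZl.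
    by lin_coefs R[i]; rewrite ?mulr1 ?subr0 ?(mulrC (t ^- 2)%:C) ?t2C; ring.
  rewrite nrmZr ger0_norm ?invr_ge0 ?(ltW t2) // ler_pdivrMl //.
have [u [uE u_le us uc]] := formal_sqrt (mul1r 1) y'_le.
have uu : amul u u = - y'.
  have -> : amul u u = 2%:C *: u - y' - (2 * 1)%:C *: u by rewrite uE; lin_comb R[i].
  by lin_comb R[i].
exists (- (t%:C *: u)); split.
- by rewrite starN starZr us // /y' starN starZr yy.
- rewrite amulNl amulNr opprK amulZl amulZr uu /y' opprK !scalerA.
  by rewrite -rmorphM -expr2 t2C scale1r.
- move=> b yb; rewrite amulNl amulNr amulZl amulZr uc //.
  by rewrite /y' amulNl amulNr amulZl amulZr yb.
move=> z; have -> : t%:C *: z - amul (- (t%:C *: u)) z = t%:C *: (1%:C *: z + amul u z).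
  by rewrite amulNl amulZl; lin_comb R[i].
by rewrite nrmZr ger0_norm ?(ltW t0) // ler_wpM2l // ltW.
Qed.

(* With q = h p^*, both q q^* and q^* q are minus squares of selfadjoint       *)
(* elements, while their sum is half the sum of the squares of q + q^* and    *)
(* i (q - q^* ).                                                               *)
Lemma star_amul_neg_square p h :
  star h = h -> amul (star p) p = - amul h h -> h = 0.
Proof.
move=> hh ph; pose q := amul h (star p).
have qs : star q = amul p h by rewrite /q starM starK hh.
pose k := amul h h; pose y := amul p (star p).
have kk : star k = k by rewrite /k starM hh.
have yy : star y = y by rewrite /y starM starK.
have qqs : amul q (star q) = - amul k k.
  by rewrite qs /q -amulA [amul (star p) _]amulA ph amulNl amulNr /k !amulA.
have qsq : amul (star q) q = - amul y y.
  have -> : amul (star q) q = amul p (amul (amul h h) (star p)).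
    by rewrite qs /q !amulA.
  have -> : amul h h = - amul (star p) p by rewrite ph opprK.
  by rewrite amulNl amulNr /y !amulA.
pose u := q + star q; pose v := 'i *: (q - star q).
have us : star u = u by rewrite /u starD starK addrC.
have vs : star v = v.
  by rewrite /v starZ conjCi starD starN starK; lin_comb R[i].
have i2 : 'i * 'i = -1 :> R[i] by rewrite -expr2 sqrCi.
have uv : amul u u + amul v v = - (2%:C *: amul k k) - 2%:C *: amul y y.
  have -> : amul u u + amul v v = 2%:C *: amul q (star q) + 2%:C *: amul (star q) q.
    rewrite /u /v !(amulDl, amulDr, amulNl, amulNr, amulZl, amulZr).
    by lin_coefs R[i]; ring: i2.
  by rewrite qqs qsq; lin_comb R[i].
pose t := nrm u + nrm v + nrm y + 1.
have u0 := nrm_ge0 u; have v0 := nrm_ge0 v; have y0 := nrm_ge0 y.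
have t0 : 0 < t by rewrite /t; lra.
have sq b z : star b = b -> nrm b <= t ->
    nrm ((t ^+ 2)%:C *: z - amul (amul b b) z) <= t ^+ 2 * nrm z.
  by move=> bb bt; exact: square_contraction.
(* - k^2 = (u^2 + v^2) / 2 + y^2 is a sum of squares, so it satisfies the hypothesis of
   [positive_sqrt]. *)
have k_le z : nrm (((2 * t) ^+ 2)%:C *: z - amul (- amul k k) z) <= (2 * t) ^+ 2 * nrm z.
  pose f b := (t ^+ 2)%:C *: z - amul (amul b b) z.
  have -> : ((2 * t) ^+ 2)%:C *: z - amul (- amul k k) z =
      2^-1%:C *: (((2 * t) ^+ 2)%:C *: z + (f u + f v + 2%:C *: f y)).
    have kkE : amul (amul k k) z =
        - (2^-1%:C *: (amul (amul u u) z + amul (amul v v) z)) - amul (amul y y) z.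
      by rewrite -amulDl uv amulDl !amulNl !amulZl; lin_comb R[i].
    by rewrite amulNl kkE /f; lin_comb R[i].
  have f_le : nrm (f u + f v + 2%:C *: f y) <= (2 * t) ^+ 2 * nrm z.
    have := nrmD (f u + f v) (2%:C *: f y); have := nrmD (f u) (f v).
    rewrite nrmZr ger0_norm //.
    have : nrm (f u) <= t ^+ 2 * nrm z by apply: sq => //; rewrite /t; lra.
    have : nrm (f v) <= t ^+ 2 * nrm z by apply: sq => //; rewrite /t; lra.
    have : nrm (f y) <= t ^+ 2 * nrm z by apply: sq => //; rewrite /t; lra.
    by lra.
  have z_le : nrm (((2 * t) ^+ 2)%:C *: z) <= (2 * t) ^+ 2 * nrm z.
    by rewrite nrmZr ger0_norm // sqr_ge0.
  by apply: le_trans (nrm_half z_le f_le) _; lra.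
have [||c [cc c2 ck _]] := positive_sqrt _ _ k_le.
- by lra.
- by rewrite starN starM kk.
have {}ck : amul c k = amul k c by apply: ck; rewrite amulNl amulNr amulA.
(* As c commutes with k and c^2 = - k^2, the C*-square of k + i c is k^2 + c^2 = 0. *)
have w0 : k + 'i *: c = 0.
  apply: star_amul_eq0; rewrite starD starZ conjCi kk cc.
  rewrite !(amulDl, amulDr, amulZl, amulZr) ck c2.
  by lin_coefs R[i]; ring: i2.
have k0 : k = 0.
  have ws0 : k - 'i *: c = 0.
    by have := congr1 star w0; rewrite starD starZ conjCi kk cc star0 scaleNr.
  have -> : k = 2^-1%:C *: ((k + 'i *: c) + (k - 'i *: c)) by lin_comb R[i].
  by rewrite w0 ws0 addr0 scaler0.
by apply: star_amul_eq0; rewrite hh; exact: k0.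
Qed.

End Positivity.

(** As [theta x x] is self-adjoint, [a] may be replaced by its real part. With m = |a| in the sense
    of the square root of a^2, n = m - a is twice the negative part of [a]; once phi kills n, the
    root r of m is a root of [theta x x] under phi. *)
Lemma theta_sqrt (R : realType) (A B : cstarAlgType R) (X : hilbertModType B)
    (phi : {starhom A -> adjointable X}) (x : X) (a : A) :
  phi a = theta x x -> exists2 c, star c = c & phi (amul c c) = theta x x.
Proof.
move=> a_theta; wlog aa : a a_theta / star a = a => [wl|].
  apply: (wl (re_part a)); last exact: re_partS.
  have thetaS : adj (theta x x) = theta x x by apply: adj_uniq; exact: theta_adjoint.
  apply: adjointable_eq => z; rewrite homZE homDE.
  have -> : phi (star a) z = adj (phi a) z by rewrite starhom_star.
  by rewrite a_theta thetaS; lin_comb R[i].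
(* Two roots are taken, of a^2 at scale t^2 and then of m at scale t; the first needs |a| <= t^2. *)
pose t := 1 + nrm a; have a0 := nrm_ge0 a.
have t0 : 0 < t by rewrite /t; lra.
have at_ : nrm a <= t ^+ 2 by rewrite /t; nra.
have t2 : 0 < t ^+ 2 by rewrite exprn_gt0.
have aaS : star (amul a a) = amul a a by rewrite starM aa.
have [m [mm m2 mc m_le]] := positive_sqrt t2 aaS (square_contraction aa t2 at_).
have [r [rr r2 rc _]] := positive_sqrt t0 mm m_le.
have ma : amul m a = amul a m by apply: mc; rewrite amulA.
have rm : amul r m = amul m r by apply: rc.
have ra : amul r a = amul a r by apply: rc.
pose n := m - a; pose v := amul r n.
have nn : star n = n by rewrite /n starD starN mm aa.
have rn : amul r n = amul n r.
  by rewrite /n amulDr amulDl amulNr amulNl rm ra.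
have mn : amul m n = amul n m.
  by rewrite /n amulDr amulDl amulNr amulNl ma.
have an : amul a n = - amul m n.
  by rewrite /n !amulDr !amulNr m2 ma opprD opprK addrC.
have vs : star v = v by rewrite /v starM rr nn rn.
have vv : amul v v = amul m (amul n n).
  by rewrite /v -amulA [amul n (amul r n)]amulA -rn -amulA amulA r2.
have nan : amul n (amul a n) = - amul v v.
  by rewrite an amulNr vv amulA -mn amulA.
pose y := phi n x.
(* phi(n a n) is [theta y y], while n a n = - v^2 because a n = - m n. *)
have thetaE z : ract y (rip y z) = - phi (amul v v) z.
  rewrite -homNE -nan !homME a_theta /= adjointable_ract -/y; congr ract.
  by rewrite /y hom_adjoint.
have y0 : y = 0.
  apply: rip_eq0; have [p pE] := rip_nonneg (phi v y).
  apply: (@star_amul_neg_square R B p); first by rewrite rip_star.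
  rewrite -pE -ripM thetaE ripNr opprK homME.
  by rewrite (hom_adjoint phi vs).
have v0 : phi v = 0.
  apply: hom_square_eq0 => //; apply: adjointable_eq => z.
  rewrite -[LHS]opprK -thetaE y0 rip0l -[in LHS](scale0r (0 : B)) ractZr.
  by rewrite scale0r oppr0.
have mn0 : phi (amul m n) = 0.
  by apply: adjointable_eq => z; rewrite -r2 -amulA homME v0 adjointable0.
have n0 : phi n = 0.
  (* n^2 = 2 m n, and m n = r v is killed by phi. *)
  apply: hom_square_eq0 => //.
  have -> : amul n n = amul m n + amul m n by rewrite {1}/n amulDl amulNl an opprK.
  by rewrite raddfD /= mn0 addr0.
exists r => //; rewrite r2 -a_theta.
apply: adjointable_eq => z; apply/eqP; rewrite -subr_eq0 -homNE -homDE -/n n0.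
exact: eqxx.
Qed.

(** * Compact maps *)

Section Compact.
Context (R : realType) (B : cstarAlgType R) (X : hilbertModType B).
Implicit Types (U V : adjointable X) (x y z : X).

Lemma opnorm_bounded U (t : R) : (opnorm U < t%:E)%E -> bounded_by U t.
Proof.
move=> Ut; have unit_le z : nrm z <= 1 -> nrm (U z) <= t.
  move=> z1; rewrite -lee_fin; apply: le_trans (ltW Ut).
  by apply: ereal_sup_ubound; exists z => //=; rewrite nrmE lecR.
move=> z; have [-> | /eqP z0] := eqVneq z 0.
  by rewrite adjointable0 nrm0 mulr0.
have z_gt0 : 0 < nrm z by rewrite lt0r nrm_ge0 andbT; apply/eqP => /nrm_eq0.
have := unit_le ((nrm z)^-1%:C *: z).
rewrite adjointableZ !nrmZr ger0_norm ?invr_ge0 ?nrm_ge0 // mulVf ?gt_eqF //.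
by rewrite lexx ler_pdivrMl // mulrC => ->.
Qed.

Lemma theta_finite_rank x y : finite_rank (theta x y).
Proof.
exists 1%N, (fun=> 1), (fun=> x), (fun=> y).
by rewrite big_ord1 scale1r.
Qed.

Lemma theta_compact x y : compact_maps X (theta x y).
Proof.
move=> e e0; exists (theta x y); first exact: theta_finite_rank.
apply: le_lt_trans (e0 : (0 < e%:E)%E); apply: ge_ereal_sup => _ [z _ <-] /=.
by rewrite subrr normr0.
Qed.

Lemma finite_rank_bounded U : finite_rank U -> exists t : R, bounded_by U t.
Proof.
move=> [n [c [x [y ->]]]].
apply: (big_ind (fun V : adjointable X => exists t : R, bounded_by V t)).
- by exists 0 => z; rewrite mul0r nrm0.
- by move=> V W [t Vt] [r Wr]; exists (t + r); exact: boundedD.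
move=> i _; exists (complex.Re `|c i| * (4 * nrm (x i) * nrm (y i))) => z.
have -> : (c i *: theta (x i) (y i)) z = c i *: theta (x i) (y i) z by [].
rewrite nrmZ -[leRHS]mulrA; apply: ler_wpM2l.
  by rewrite -ler0c RRe_real ?normr_real.
exact: nrm_theta_le.
Qed.

End Compact.

(** * The quotient norm and the left inner product *)

Section Bimodule.
Context (R : realType) (A B : cstarAlgType R) (X : hilbertModType B).
Context (phi : {starhom A -> adjointable X}).
Implicit Types (x y z : X) (u : coimage phi).

Lemma induced_homE (a : A) : induced_hom phi (coproj phi a) = phi a.
Proof. exact: induced_hom_coproj. Qed.

Lemma quotient_norm_ge0 u : 0 <= quotient_norm phi u.
Proof.
apply: lb_le_inf => [|_ [a _ <-]]; last exact: nrm_ge0.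
by exists (nrm (repr u)), (repr u) => //; exact: coprojK.
Qed.

Lemma quotient_norm_le (a : A) : quotient_norm phi (coproj phi a) <= nrm a.
Proof.
apply: ge_inf; last by exists a.
by exists 0 => _ [b _ <-]; exact: nrm_ge0.
Qed.

(** Every lift satisfies [hom_bounded]; lifts of norm close to the infimum give the claim. *)
Lemma induced_hom_bounded u : bounded_by (induced_hom phi u) (2 * quotient_norm phi u).
Proof.
move=> z; apply/ler_addgt0Pr => e e0.
have z1 : 0 < 2 * (nrm z + 1) by have := nrm_ge0 z; lra.
have d0 : 0 < e / (2 * (nrm z + 1)) by rewrite divr_gt0.
have hi : has_inf [set complex.Re `|a| | a in [set a | coproj phi a = u]].
  split; first by exists (nrm (repr u)), (repr u) => //; exact: coprojK.
  by exists 0 => _ [b _ <-]; exact: nrm_ge0.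
have [_ [a /= <- <-] aP] := inf_adherent d0 hi.
rewrite -/(quotient_norm phi _) in aP *.
rewrite induced_homE; apply: le_trans (hom_bounded phi a z) _.
have dz : e / (2 * (nrm z + 1)) * (2 * (nrm z + 1)) = e by rewrite divfK // gt_eqF.
set d := e / _ in aP d0 dz; rewrite -/(nrm a) in aP.
by have := nrm_ge0 z; nra.
Qed.

Lemma induced_hom_left_ip (lip : X -> X -> coimage phi) :
  (forall x y z, induced_hom phi (lip x y) z = ract x (rip y z)) ->
  forall x y, induced_hom phi (lip x y) = theta x y.
Proof. by move=> lipE x y; apply: adjointable_eq => z; exact: lipE. Qed.

Lemma compact_maps_range (lip : X -> X -> coimage phi) :
  (forall x y z, induced_hom phi (lip x y) z = ract x (rip y z)) ->
  compact_maps X `<=` range phi.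
Proof.
move=> /induced_hom_left_ip lipE U Ucompact.
have fr_range V : finite_rank V -> exists a, phi a = V.
  move=> [n [c [x [y ->]]]].
  apply: (big_ind (fun V : adjointable X => exists a, phi a = V)).
  - by exists 0; rewrite raddf0.
  - by move=> _ _ [a <-] [b <-]; exists (a + b); rewrite raddfD.
  move=> i _; exists (c i *: repr (lip (x i) (y i))); apply: adjointable_eq => z.
  have -> : (c i *: theta (x i) (y i)) z = c i *: theta (x i) (y i) z by [].
  by rewrite homZE -lipE -[in RHS](coprojK (lip _ _)) induced_homE.
(* One finite rank approximation, at distance 1, shows that U is bounded. *)
have [W Wfr UW] := Ucompact 1 ltr01.
have [t Wt] := finite_rank_bounded Wfr.
apply: (@range_closed _ _ _ _ phi U (1 + t)).
  rewrite -[U](subrK W); apply: boundedD => //; exact: opnorm_bounded.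
move=> e /Ucompact[V /fr_range[a <-] aP]; exists a; exact: opnorm_bounded.
Qed.

Section LeftInnerProduct.
Hypothesis theta_phi : forall x y, exists a, phi a = theta x y.

(** A lift is chosen, but its class modulo the kernel is the unique preimage of [theta x y]. *)
Definition left_rip x y : coimage phi := coproj phi (sval (cid (theta_phi x y))).

Lemma left_ripE x y : induced_hom phi (left_rip x y) = theta x y.
Proof. by rewrite induced_homE; exact: svalP (cid (theta_phi x y)). Qed.

Lemma left_rip_nonneg x : star_nonneg (left_rip x x).
Proof.
have [a aE] := theta_phi x x.
have [c cc cE] := theta_sqrt aE.
exists (coproj phi c); apply: (@induced_hom_inj _ _ _ phi).
rewrite left_ripE induced_homM induced_hom_star induced_homE.
by rewrite -starhom_star cc -starhomM cE.
Qed.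

(** Below, [theta x x] is at least |x|^2 by [nrm_theta_ge]. Above, it is bounded by 4 |x|^2, so
    [selfadjoint_range] lifts it to an element of norm at most 16 |x|^2; the constant 64 is the
    slack that makes the square root exactly 8. *)
Lemma quotient_norm_left_rip x :
  nrm x ^+ 2 <= 2 * quotient_norm phi (left_rip x x) /\
  quotient_norm phi (left_rip x x) <= 64 * nrm x ^+ 2.
Proof.
split.
  apply: nrm_theta_ge; first by rewrite mulr_ge0 // quotient_norm_ge0.
  by move=> z; rewrite -left_ripE; exact: induced_hom_bounded.
(* [selfadjoint_range] asks for a positive bound, so x = 0 is treated apart. *)
have [->|/eqP x0] := eqVneq x 0.
  have -> : left_rip 0 0 = coproj phi 0.
    apply: (@induced_hom_inj _ _ _ phi); rewrite left_ripE induced_homE raddf0.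
    by apply: adjointable_eq => z /=; rewrite rip0l -(scale0r (0 : B)) ractZr scale0r.
  by apply: le_trans (quotient_norm_le _) _; rewrite !nrm0 expr0n mulr0.
have x_gt0 : 0 < nrm x by rewrite lt0r nrm_ge0 andbT; apply/eqP => /nrm_eq0.
have [||z|e e0|b bE b_le] := @selfadjoint_range _ _ _ _ phi (theta x x) (4 * nrm x ^+ 2).
- exact: theta_adjoint.
- by rewrite mulr_gt0 // exprn_gt0.
- by apply: le_trans (nrm_theta_le _ _ _) _; rewrite expr2 !mulrA.
- have [a aE] := theta_phi x x; exists a => z.
  by rewrite aE subrr nrm0 mulr_ge0 ?nrm_ge0 // ltW.
have -> : left_rip x x = coproj phi b.
  by apply: (@induced_hom_inj _ _ _ phi); rewrite left_ripE induced_homE bE.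
apply: le_trans (quotient_norm_le _) _.
by have := sqr_ge0 (nrm x); lra.
Qed.

Lemma left_rip_complete :
  complete_for (fun x : X => Num.sqrt (quotient_norm phi (left_rip x x))).
Proof.
set N := fun x => _.
have N_ge x : nrm x <= 2 * N x.
  have [x_le _] := quotient_norm_left_rip x.
  have qE : N x ^+ 2 = quotient_norm phi (left_rip x x).
    by rewrite sqr_sqrtr // quotient_norm_ge0.
  rewrite -qE in x_le; have := sqrtr_ge0 (quotient_norm phi (left_rip x x)).
  by rewrite -/(N x); have := nrm_ge0 x; nra.
have N_le x : N x <= 8 * nrm x.
  have [_ x_le] := quotient_norm_left_rip x.
  rewrite /N -[leRHS]ger0_norm ?mulr_ge0 ?nrm_ge0 // -sqrtr_sqr ler_sqrt ?sqr_ge0 //.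
  by rewrite exprMn; lra.
move=> u u_cauchy; have [|l ul] := @nrm_complete R X u.
  move=> e e0; have [|n0 n0P] := u_cauchy (4^-1 * e); first by lra.
  exists n0 => m n n0m n0n; have := N_ge (u m - u n).
  by have := n0P m n n0m n0n; rewrite -/(N _); lra.
exists l => e e0; have [|n0 n0P] := ul (9^-1 * e); first by lra.
exists n0 => n n0n; rewrite -/(N (u n - l)).
by have := N_le (u n - l); have := n0P n n0n; lra.
Qed.

(** By injectivity of phi_0, the algebraic axioms for the inner product reduce to identities between
    the maps [theta x y]; definiteness comes from the lower norm bound. *)
Lemma left_rip_bimodule :
  hilbert_bimodule (quotient_norm phi) (fun u x => induced_hom phi u x) left_rip.
Proof.
have inj := @induced_hom_inj _ _ _ phi.
split; last by move=> x y z; rewrite left_ripE.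
split.
- by move=> a b x; rewrite induced_homM.
- by move=> a b x; rewrite raddfD.
- by move=> a x y; rewrite adjointableD.
- by move=> k a x; rewrite linearZ.
- by move=> k a x; rewrite adjointableZ.
- move=> x y z; apply: inj; rewrite raddfD /= !left_ripE.
  by apply: adjointable_eq => w /=; rewrite ractDl.
- move=> k x y; apply: inj; rewrite linearZ /= !left_ripE.
  by apply: adjointable_eq => w /=; rewrite ractZl.
- move=> a x y; apply: inj; rewrite induced_homM !left_ripE.
  by apply: adjointable_eq => w /=; rewrite adjointable_ract.
- move=> x y; apply: inj; rewrite induced_hom_star !left_ripE.
  by apply: adj_uniq; exact: theta_adjoint.
- exact: left_rip_nonneg.
- move=> x x0; have [x_le _] := quotient_norm_left_rip x.
  apply: nrm_eq0; apply/eqP; rewrite -sqrf_eq0; apply/eqP/le_anti; rewrite sqr_ge0 andbT.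
  apply: le_trans x_le _; rewrite x0.
  have -> : 0 = coproj phi 0 by apply: (addrI (coproj phi 0)); rewrite -coprojD !addr0.
  have := quotient_norm_le 0; rewrite nrm0; lra.
- exact: left_rip_complete.
Qed.

End LeftInnerProduct.
End Bimodule.

Theorem theorem4p8 (R : realType) (A B : cstarAlgType R) (X : hilbertModType B)
    (phi : {starhom A -> adjointable X}) :
  (exists! lip : X -> X -> coimage phi,
     hilbert_bimodule (quotient_norm phi) (fun a x => induced_hom phi a x) lip)
  <-> compact_maps X `<=` range phi.
Proof.
split=> [[lip [[_ lipE] _]]|K_range]; first exact: compact_maps_range lipE.
have theta_phi x y : exists a, phi a = theta x y.
  by have [a _ aE] := K_range _ (theta_compact x y); exists a.
exists (left_rip theta_phi); split; first exact: left_rip_bimodule.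
move=> lip [_ /induced_hom_left_ip lipE]; apply/funext => x; apply/funext => y.
by apply: (@induced_hom_inj _ _ _ phi); rewrite left_ripE lipE.
Qed.
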